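(* Let $(M,g)$ be a compact, oriented smooth Riemannian manifold with boundary $\partial M$, let $j:\partial M\to M$ be the inclusion, and let $v$ be a smooth vector field on $M$. Then the boundary value problem for $k$-forms $$\Delta_v\omega=\eta\ \text{ on }M,\qquad j^*\omega=0\ \text{ and }\ j^*(\delta_v\omega)=0\ \text{ on }\partial M$$ is elliptic in the sense of the Lopatinskii--Shapiro condition.
   Context: $\Omega^k(M)$ is the space of smooth differential $k$-forms on $M$, $d$ is the exterior derivative, and $\star$ is the Hodge star of $g$. The codifferential on $k$-forms is $\delta=(-1)^k\star^{-1}d\star$. Let $v^\flat=g(v,\cdot)$, let $\iota_v$ be the interior product (zero on $0$-forms), and set $T_v=\mathrm{id}+v^\flat\wedge\iota_v$ on $k$-forms, which is a pointwise invertible bundle map. The $v$-induced codifferential is $\delta_v=T_v^{-1}\delta T_v$ (equivalently $(-1)^k\star_v^{-1}d\star_v$ on $k$-forms with $\star_v=\star T_v$), and $\Delta_v=d\delta_v+\delta_v d$. The operator $\Delta_v$ is considered on the $H^2$-completion $H^2\bar\Omega^k_{n,v}(M)$ of $\bar\Omega^k_{n,v}(M)=\{\omega\in\Omega^k(M)\mid j^*\omega=0,\ j^*(\delta_v\omega)=0\}$, with values in $L^2\Omega^k(M)$, and is then denoted $\Delta_{n,v}$. Ellipticity in the Lopatinskii--Shapiro sense has its standard meaning: $\Delta_v$ has invertible principal symbol at all nonzero covectors, and at every $x\in\partial M$ and every nonzero $\xi'\in T_x^*\partial M$, the ordinary differential boundary problem on the half-line $[0,\infty)$ in the inward normal variable,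 obtained by freezing coefficients at $x$ and taking the principal parts of $\Delta_v$ and of the two boundary operators $\omega\mapsto j^*\omega$ (order $0$, values in $\Lambda^kT^*\partial M$) and $\omega\mapsto j^*(\delta_v\omega)$ (order $1$, values in $\Lambda^{k-1}T^*\partial M$) with tangential covector $\xi'$, has, for every choice of boundary data in $\Lambda^kT_x^*\partial M\oplus\Lambda^{k-1}T_x^*\partial M$, exactly one solution of the homogeneous ODE that is bounded on $[0,\infty)$. *)

(* Defs.v *)
From HB Require Import structures.
From mathcomp Require Import all_boot all_order all_algebra.
From mathcomp Require Import all_classical all_reals all_analysis.
From mathcomp Require Import complex.

Set Implicit Arguments.
Unset Strict Implicit.
Unset Printing Implicit Defensive.

Import Order.TTheory GRing.Theory Num.Theory.
Import numFieldNormedType.Exports.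

Local Open Scope ring_scope.

(** * Exterior algebra of an n-dimensional cotangent space in coordinates

    The element [w] stands for the sum over [A] of [w A] dx^A, where
    dx^A = dx^a1 /\ ... /\ dx^ak for A = {a1 < ... < ak}.  Tangent vectors and
    covectors are rows: [v] is sum_i v_i d/dx^i and [xi] is sum_i xi_i dx^i. *)

Definition ext (F : fieldType) (n : nat) := {ffun {set 'I_n} -> F^o}.

Section Exterior.
Variables (F : fieldType) (n : nat).
Implicit Types (w e : ext F n) (A B : {set 'I_n}).

(* Degrees are integers so that there are no nonzero forms of degree -1. *)
Definition homog (k : int) w : Prop := forall A, w A != 0 -> #|A|%:Z = k.

Definition dx A : ext F n := [ffun B => (B == A)%:R].

Definition covec (xi : 'rV[F]_n) : ext F n := \sum_i xi 0 i *: dx [set i]%SET.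

(* dx^A /\ dx^B = shuffle_sign A B dx^(A U B) for disjoint A and B *)
Definition shuffle_sign A B : F :=
  (-1) ^+ #|[set ab in finset.setX A B | (ab.2 < ab.1)%N]%SET|.

Definition wedge e w : ext F n :=
  \sum_(A : {set 'I_n}) \sum_(B : {set 'I_n} | [disjoint A & B])
    (shuffle_sign A B * e A * w B) *: dx (A :|: B)%SET.

Definition iprod (v : 'rV[F]_n) w : ext F n :=
  \sum_(A : {set 'I_n}) \sum_(i in A)
    ((-1) ^+ #|[set a in A | (a < i)%N]%SET| * v 0 i * w A) *: dx (A :\ i)%SET.

Definition deg_sign w : ext F n := [ffun A : {set 'I_n} => (-1) ^+ #|A| * w A].

(* All indices raised by the metric [G]: dx^C is sent to the ordered wedge
   product of the rows of G^-1 indexed by C. *)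
Definition raise (G : 'M[F]_n) w : ext F n :=
  \sum_(C : {set 'I_n})
    w C *: \big[wedge/dx finset.set0]_(c <- enum C) covec (row c (invmx G)).

(* The inner product induced by [G]; on decomposable forms it is the Gram
   determinant of the covectors for G^-1. *)
Definition inner (G : 'M[F]_n) e w : F :=
  \sum_(A : {set 'I_n}) e A * raise G w A.

Definition lfinv (f : ext F n -> ext F n) : ext F n -> ext F n :=
  ((linfun f)^-1)%VF.

(* v^flat = g(v, .) *)
Definition flat (G : 'M[F]_n) (v : 'rV[F]_n) : 'rV[F]_n := v *m G.

Definition Tmap (G : 'M[F]_n) (v : 'rV[F]_n) w : ext F n :=
  w + wedge (covec (flat G v)) (iprod v w).

(* Pull-back to the hyperplane x^i0 = 0, whose coordinates are the
   remaining ones, renumbered by [lift i0]. *)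
Definition restr (i0 : 'I_n) w : ext F n.-1 :=
  [ffun B : {set 'I_n.-1} => w [set lift i0 b | b in B]%SET].

End Exterior.

(* The form star w for which  e /\ star w = <e, w> mu  whenever e and w have
   the same degree, where mu = s sqrt(det G) dx^1 /\ ... /\ dx^n is the
   Riemannian volume form, s being +1 in positively oriented coordinates and
   -1 otherwise; its coefficients are read off by taking e = dx^(~: B). *)
Definition hodge (R : realType) (n : nat) (s : R) (G : 'M[R]_n)
    (w : ext R n) : ext R n :=
  [ffun B : {set 'I_n} => shuffle_sign R (~: B)%SET B *
     inner G (dx R (~: B)%SET) w * (s * Num.sqrt (\det G))].

Local Open Scope classical_set_scope.

(** * Calculus on the half-space

    When n > 0 the half-space is x_0 >= 0; when n = 0 it is the point. *)

Section Calculus.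
Variables (R : realType) (n : nat).

Definition halfspace : set 'rV[R]_n :=
  [set x | forall i : 'I_n, val i = 0%N -> 0 <= x 0 i].

Definition diff_quot (i : 'I_n) (f : 'rV[R]_n -> R) (x : 'rV[R]_n) : R -> R :=
  fun h => h^-1 * (f (x + h *: delta_mx 0 i) - f x).

Definition dir_nbhs (i : 'I_n) (x : 'rV[R]_n) : set_system R :=
  within [set h | halfspace (x + h *: delta_mx 0 i)] 0^'.

(* one-sided at the boundary of the half-space *)
Definition pderiv (i : 'I_n) (f : 'rV[R]_n -> R) (x : 'rV[R]_n) : R :=
  lim (diff_quot i f x @ dir_nbhs i x).

Definition pderivs (s : seq 'I_n) (f : 'rV[R]_n -> R) : 'rV[R]_n -> R :=
  foldr pderiv f s.

(* Smoothness up to the boundary, for [O] relatively open in the half-space: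
   all iterated partial derivatives exist and are continuous on [O]. *)
Definition smooth_on (O : set 'rV[R]_n) (f : 'rV[R]_n -> R) : Prop :=
  forall (s : seq 'I_n) (x : 'rV[R]_n), O x ->
    (forall i, cvg (diff_quot i (pderivs s f) x @ dir_nbhs i x)) /\
    (pderivs s f @ within halfspace (nbhs x) --> pderivs s f x).

End Calculus.

(** * Compact oriented Riemannian manifolds with boundary *)

Record atlas (R : realType) (n : nat) (M : topologicalType) := Atlas {
  chart : Type;
  dom : chart -> set M;
  coord : chart -> M -> 'rV[R]_n;
  param : chart -> 'rV[R]_n -> M;
  img := fun c => coord c @` dom c;
  overlap := fun c c' => coord c @` (dom c `&` dom c');
  trans := fun c c' x => coord c' (param c x);
  dom_open : forall c, open (dom c);
  dom_cover : forall p, exists c, dom c p;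
  coordK : forall c p, dom c p -> param c (coord c p) = p;
  coord_cont : forall c, {within dom c, continuous (coord c)};
  param_cont : forall c, {within img c, continuous (param c)};
  img_open : forall c, exists2 W : set 'rV[R]_n,
    open W & img c = W `&` @halfspace R n;
  trans_smooth : forall c c' (j : 'I_n),
    smooth_on (overlap c c') (fun x => trans c c' x 0 j)
}.

Section Geometry.
Variables (R : realType) (n : nat) (M : topologicalType) (A : atlas R n M).

(* Rows are indexed by the source: components of vectors transform by
   right multiplication. *)
Definition trans_jac (c c' : chart A) (x : 'rV[R]_n) : 'M[R]_n :=
  \matrix_(a, b) pderiv a (fun y => trans c c' y 0 b) x.

(* The sign of each chart relative to the orientation.  It is allowed to be
   negative because one-dimensional manifolds need not be covered by
   positively oriented charts with values in the half-line x_0 >= 0. *)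
Record orientation := Orientation {
  osign : chart A -> 'rV[R]_n -> R;
  osignP : forall c x, img c x -> osign c x = 1 \/ osign c x = -1;
  osign_cont : forall c, {within img c, continuous (osign c)};
  osign_compat : forall c c' x, overlap c c' x ->
    osign c' (trans c c' x) = Num.sg (\det (trans_jac c c' x)) * osign c x
}.

Record riemannian := Riemannian {
  metric : chart A -> 'rV[R]_n -> 'M[R]_n;
  metric_smooth : forall c a b, smooth_on (img c) (fun x => metric c x a b);
  metric_sym : forall c x, img c x -> (metric c x)^T = metric c x;
  metric_pos : forall c x, img c x ->
    forall u : 'rV[R]_n, u != 0 -> 0 < (u *m metric c x *m u^T) 0 0;
  metric_compat : forall c c' x, overlap c c' x ->
    metric c x =
      trans_jac c c' x *m metric c' (trans c c' x) *m (trans_jac c c' x)^T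
}.

Record vector_field := VectorField {
  vfield : chart A -> 'rV[R]_n -> 'rV[R]_n;
  vfield_smooth : forall c a, smooth_on (img c) (fun x => vfield c x 0 a);
  vfield_compat : forall c c' x, overlap c c' x ->
    vfield c' (trans c c' x) = vfield c x *m trans_jac c c' x
}.

End Geometry.

(** * Operators on differential forms, in a chart *)

Definition dform (R : realType) (n : nat) := 'rV[R]_n -> ext R n.

Section Operators.
Variables (R : realType) (n : nat).
(* orientation sign, metric and vector field in the chart *)
Variables (s : 'rV[R]_n -> R) (G : 'rV[R]_n -> 'M[R]_n)
  (v : 'rV[R]_n -> 'rV[R]_n).
Implicit Types w : dform R n.

Definition ext_d w : dform R n := fun x =>
  \sum_(i < n) wedge (dx R [set i]%SET) [ffun A => pderiv i (fun y => w y A) x].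

Definition codiff w : dform R n := fun x =>
  lfinv (hodge (s x) (G x))
    (ext_d (fun y => hodge (s y) (G y) (deg_sign (w y))) x).

Definition codiff_v w : dform R n := fun x =>
  lfinv (Tmap (G x) (v x)) (codiff (fun y => Tmap (G y) (v y) (w y)) x).

Definition laplace_v w : dform R n := fun x =>
  ext_d (codiff_v w) x + codiff_v (ext_d w) x.

End Operators.

(** * Principal symbols *)

Definition operator (R : realType) (n n' : nat) :=
  ('rV[R]_n -> ext R n) -> 'rV[R]_n -> ext R n'.

Definition cext (R : realType) (n : nat) := ext R[i] n.

Definition complexify (R : realType) (n n' : nat) (L : ext R n -> ext R n')
    (z : cext R n) : cext R n' :=
  [ffun B => (L [ffun A => complex.Re (z A)] B +i*
              L [ffun A => complex.Im (z A)] B)%C].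

Section Symbols.
Variables (R : realType) (n n' : nat).

(* For P = sum_I a_I d_I1 ... d_Im + (terms of order < m), with a_I symmetric
   in I, this is the endomorphism a_I(x): apply P at x to
   (y - x)_I1 ... (y - x)_Im e / m!. *)
Definition top_coef (m : nat) (P : operator R n n') (x : 'rV[R]_n)
    (I : m.-tuple 'I_n) (e : ext R n) : ext R n' :=
  (m`!%:R : R)^-1 *: P (fun y => (\prod_(i <- I) (y 0 i - x 0 i)) *: e) x.

(* up to the invertible factor i^m *)
Definition symbol (m : nat) (P : operator R n n') (x xi : 'rV[R]_n)
    (e : ext R n) : ext R n' :=
  \sum_(I : m.-tuple 'I_n) (\prod_(i <- I) xi 0 i) *: top_coef P x I e.

(* The principal part of P with coefficients frozen at x, applied to
   exp(i xi(.)) y(nu(.)), and divided by the exponential: each d_j becomes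
   i xi_j + nu_j d/dt, with d/dt represented by 'X.  The argument [Y d] is the
   d-th derivative of y. *)
Definition frozen (m : nat) (P : operator R n n') (x xi nu : 'rV[R]_n)
    (Y : nat -> R -> cext R n) (t : R) : cext R n' :=
  \sum_(I : m.-tuple 'I_n) \sum_(d < m.+1)
    (\prod_(i <- I) ((0 +i* xi 0 i)%C%:P + (nu 0 i +i* 0)%C *: 'X))`_d *:
      complexify (top_coef P x I) (Y d t).

End Symbols.

(** * The Lopatinskii-Shapiro condition *)

Section HalfLine.
Variables (R : realType) (n : nat).

(* one-sided at t = 0 *)
Definition is_deriv_halfline (f f' : R -> R) : Prop :=
  forall t, 0 <= t ->
    (fun u => (f u - f t) / (u - t)) @ within [set u | 0 <= u] t^' --> f' t.

Definition is_cderiv_halfline (y y' : R -> cext R n) : Prop :=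
  forall A,
    is_deriv_halfline (fun t => complex.Re (y t A))
                      (fun t => complex.Re (y' t A)) /\
    is_deriv_halfline (fun t => complex.Im (y t A))
                      (fun t => complex.Im (y' t A)).

Definition bounded_halfline (y : R -> cext R n) : Prop :=
  exists C : R, forall t A, 0 <= t ->
    `|complex.Re (y t A)| <= C /\ `|complex.Im (y t A)| <= C.

End HalfLine.

(* A boundary value problem for k-forms given by an operator of order [ord]
   and two boundary operators, all in terms of their expressions in the charts.
   Boundary operators take values in forms on the boundary, and their second
   argument is the index 0 of the coordinate that vanishes on the boundary. *)
Record bvp (R : realType) (n : nat) (M : topologicalType) (A : atlas R n M)
    := Bvp {
  ord : nat;
  op : chart A -> operator R n n;
  deg : int;
  ord1 : nat;
  bop1 : chart A -> 'I_n -> operator R n n.-1;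
  deg1 : int;
  ord2 : nat;
  bop2 : chart A -> 'I_n -> operator R n n.-1;
  deg2 : int
}.

Section LopatinskiiShapiro.
Variables (R : realType) (n : nat) (M : topologicalType) (A : atlas R n M).
Variables (g : riemannian A) (p : bvp A).

Definition elliptic_at (c : chart A) (x : 'rV[R]_n) : Prop :=
  forall xi : 'rV[R]_n, xi != 0 ->
    forall e, homog (deg p) e ->
      exists! w, homog (deg p) w /\ symbol (ord p) (op p c) x xi w = e.

(* the inward unit normal vector and covector in a chart, where i0 = 0 *)
Definition normal_cov (c : chart A) (i0 : 'I_n) (x : 'rV[R]_n) : 'rV[R]_n :=
  (Num.sqrt (invmx (metric g c x) i0 i0))^-1 *: delta_mx 0 i0.

Definition normal_vec (c : chart A) (i0 : 'I_n) (x : 'rV[R]_n) : 'rV[R]_n :=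
  normal_cov c i0 x *m invmx (metric g c x).

Definition bounded_solution (c : chart A) (i0 : 'I_n) (x xi : 'rV[R]_n)
    (b1 b2 : cext R n.-1) (y : R -> cext R n) : Prop :=
  let nu := normal_cov c i0 x in
  exists Y : nat -> R -> cext R n,
    [/\ Y 0%N = y,
        forall d, (d < maxn (ord p) (maxn (ord1 p) (ord2 p)))%N ->
          is_cderiv_halfline (Y d) (Y d.+1),
        forall t, 0 <= t -> homog (deg p) (y t),
        forall t, 0 <= t -> frozen (ord p) (op p c) x xi nu Y t = 0 &
        [/\ bounded_halfline y,
            frozen (ord1 p) (bop1 p c i0) x xi nu Y 0 = b1 &
            frozen (ord2 p) (bop2 p c i0) x xi nu Y 0 = b2]].

(* Cotangent vectors of the boundary are identified with the covectors
   annihilating the normal vector. *)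
Definition complementing_at (c : chart A) (i0 : 'I_n) (x : 'rV[R]_n) : Prop :=
  forall xi : 'rV[R]_n, xi != 0 -> (xi *m (normal_vec c i0 x)^T) 0 0 = 0 ->
    forall b1 b2 : cext R n.-1, homog (deg1 p) b1 -> homog (deg2 p) b2 ->
      exists2 y, bounded_solution c i0 x xi b1 b2 y &
        forall y', bounded_solution c i0 x xi b1 b2 y' ->
          forall t, 0 <= t -> y' t = y t.

Definition lopatinskii_shapiro : Prop :=
  forall (c : chart A) (x : 'rV[R]_n), img c x ->
    elliptic_at c x /\
    (forall i0 : 'I_n, val i0 = 0%N -> x 0 i0 = 0 -> complementing_at c i0 x).

End LopatinskiiShapiro.

(* Delta_v on k-forms with boundary conditions j^* w = 0, j^* (delta_v w) = 0 *)
Definition normal_bvp (R : realType) (n : nat) (M : topologicalType)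
    (A : atlas R n M) (o : orientation A) (g : riemannian A)
    (v : vector_field A) (k : nat) : bvp A :=
  {| ord := 2;
     op := fun c => laplace_v (osign o c) (metric g c) (vfield v c);
     deg := k%:Z;
     ord1 := 0;
     bop1 := fun c i0 w x => restr i0 (w x);
     deg1 := k%:Z;
     ord2 := 1;
     bop2 := fun c i0 w x =>
       restr i0 (codiff_v (osign o c) (metric g c) (vfield v c) w x);
     deg2 := k%:Z - 1 |}.

(* Main.v *)
From HB Require Import structures.
Require Import Defs.
From mathcomp Require Import all_boot all_order all_algebra.
From mathcomp Require Import all_classical all_reals all_analysis.
From mathcomp Require Import complex ring lra.

(** Let h = g^-1 + v (x) v, a cometric larger than that of g in the direction
    of v.  The map T_v only rescales the components along v^flat, and it does so
    in such a way that the inner product <T_v ., .> on forms is the one induced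
    by h; in algebraic terms, T_v^-1 i T_v is contraction with xi raised by h
    when i is contraction with xi raised by g^-1 ([Tmap_iprod]).  Since the Hodge
    star exchanges wedging and contraction ([dx_hodge]), the principal symbol
    of delta_v at xi is minus the contraction with xi h ([star_v_symbol]).
    Wedging and contraction anticommute up to a scalar
    ([anticomm_covec_iprod]), so the symbol of Delta_v is the scalar
    - h(xi, xi), which vanishes for xi = 0 only.

    Principal parts are read off from the action of the operators on monomials
    (y - x)_I e.  The coefficients of delta_v involve determinants, inverses and
    a square root of functions that are smooth up to the boundary; they are C1
    there, so that delta_v obeys a product rule with a continuous zeroth-order
    term ([codiff_v_leibniz]).  At x every term in which a factor y - x is
    left over disappears ([top_coef_codiff_v], [top_coef_laplace_v]).

    At a boundary point with conormal nu, and for xi orthogonal to nu, put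
    a = h(nu, nu), b = h(xi, nu) and c = h(xi, xi).  The frozen equation is
    a y'' + 2 i b y' - c y = 0 for each component of y ([frozen2E]).  Because
    xi and nu are linearly independent, a c - b^2 > 0 and the two characteristic
    roots lie on either side of the imaginary axis: bounded solutions are
    y(t) = exp(lam t) y(0) with Re lam < 0 ([bounded_complex_decay]).  On such
    a solution the second boundary operator contracts y(0) with the complex
    vector (i xi + lam nu) h, restricts and changes the sign.  That
    vector is transverse to the boundary ([normal_char_neq0]), so the two
    boundary values determine y(0), and can be prescribed: the first is its
    tangential part and the second then yields its normal part
    ([restr_iprod_inj], [restr_iprod_surj]). *)

Set Implicit Arguments.
Unset Strict Implicit.
Unset Printing Implicit Defensive.

Import Order.TTheory GRing.Theory Num.Theory.
Import numFieldNormedType.Exports.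

Local Open Scope ring_scope.

(** * Exterior algebra in coordinates *)

Section ExteriorAlgebra.
Variables (F : fieldType) (n : nat).
Implicit Types (w e : ext F n) (A B C : {set 'I_n}) (i j : 'I_n).

(** The sign of sorting dx^i /\ dx^A for i outside A. *)
Definition ins_sign i A : F := (-1) ^+ #|[set a in A | (a < i)%N]|.

Lemma ins_sign_sq i A : ins_sign i A * ins_sign i A = 1.
Proof. by rewrite -expr2 /ins_sign sqrr_sign. Qed.

Lemma ins_signD1 i j B : ins_sign j (B :\ i) = ins_sign j B * (-1) ^+ ((i \in B) && (i < j)%N).
Proof.
rewrite /ins_sign [in RHS](cardsD1 i) inE.
case: (boolP ((i \in B) && (i < j)%N)) => h /=.
  rewrite exprD -mulrA [_ ^+ 1 * _]mulrC -mulrA mulrN1 opprK mulr1; congr (_ ^+ _).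
  by apply: eq_card => a; rewrite !inE andbA.
rewrite expr0 mulr1 add0n; congr (_ ^+ _); apply: eq_card => a; rewrite !inE.
by case: eqP => // ->; rewrite (negbTE h).
Qed.

Lemma ins_signU1 i j B : ins_sign j (i |: B) = ins_sign j B * (-1) ^+ ((i \notin B) && (i < j)%N).
Proof.
case: (boolP (i \in B)) => iB /=; first by rewrite expr0 mulr1 (finset.setUidPr _) ?finset.sub1set.
have := ins_signD1 i j (i |: B); rewrite finset.setU1K // finset.setU11 /= => ->.
by rewrite -mulrA -expr2 sqrr_sign mulr1.
Qed.

Lemma ins_sign_self i B : ins_sign i (B :\ i) = ins_sign i B.
Proof. by rewrite ins_signD1 ltnn andbF mulr1. Qed.

Lemma ins_sign_selfU i B : ins_sign i (i |: B) = ins_sign i B.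
Proof. by rewrite ins_signU1 ltnn andbF mulr1. Qed.

Lemma dxE A B : dx F A B = (B == A)%:R.
Proof. by rewrite ffunE. Qed.

Lemma ext_sumE (I : Type) (r : seq I) (P : pred I) (f : I -> ext F n) B :
  (\sum_(i <- r | P i) f i) B = \sum_(i <- r | P i) f i B.
Proof. by rewrite sum_ffunE. Qed.

Lemma extZE (a : F) w B : (a *: w) B = a * w B.
Proof. by rewrite ffunE. Qed.

Lemma extDE w e B : (w + e) B = w B + e B.
Proof. by rewrite ffunE. Qed.

Lemma extNE w B : (- w) B = - w B.
Proof. by rewrite ffunE. Qed.

Lemma ext_eq w e : (forall B, w B = e B) -> w = e.
Proof. by move=> we; apply/ffunP. Qed.

Lemma ext_dx w : w = \sum_A w A *: dx F A.
Proof.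
apply/ffunP => B; rewrite ext_sumE (bigD1 B) //= extZE dxE eqxx mulr1 big1 ?addr0 //.
by move=> A nA; rewrite extZE dxE eq_sym (negbTE nA) mulr0.
Qed.

Lemma wedgeDl e1 e2 w : wedge (e1 + e2) w = wedge e1 w + wedge e2 w.
Proof.
rewrite /wedge -big_split; apply: eq_bigr => A _; rewrite -big_split; apply: eq_bigr => B _.
by rewrite /= ffunE mulrDr mulrDl scalerDl.
Qed.

Lemma wedgeZl a e w : wedge (a *: e) w = a *: wedge e w.
Proof.
rewrite /wedge scaler_sumr; apply: eq_bigr => A _; rewrite scaler_sumr; apply: eq_bigr => B _.
by rewrite extZE scalerA mulrCA !mulrA.
Qed.

Lemma wedgeDr e w1 w2 : wedge e (w1 + w2) = wedge e w1 + wedge e w2.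
Proof.
rewrite /wedge -big_split; apply: eq_bigr => A _; rewrite -big_split; apply: eq_bigr => B _.
by rewrite /= ffunE mulrDr scalerDl.
Qed.

Lemma wedgeZr a e w : wedge e (a *: w) = a *: wedge e w.
Proof.
rewrite /wedge scaler_sumr; apply: eq_bigr => A _; rewrite scaler_sumr; apply: eq_bigr => B _.
by rewrite extZE scalerA; congr (_ *: _); ring.
Qed.

Lemma wedge0l w : wedge 0 w = 0.
Proof. by rewrite -(scale0r 0) wedgeZl !scale0r. Qed.

Lemma wedge_suml (I : Type) (r : seq I) (P : pred I) (f : I -> ext F n) w :
  wedge (\sum_(i <- r | P i) f i) w = \sum_(i <- r | P i) wedge (f i) w.
Proof.
by apply: (big_morph (fun e => wedge e w)) => [x y|]; rewrite ?wedgeDl ?wedge0l.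
Qed.

Lemma wedge_is_linear e : linear (wedge e).
Proof. by move=> a w1 w2; rewrite wedgeDr wedgeZr. Qed.
HB.instance Definition _ e :=
  GRing.isLinear.Build F (ext F n) (ext F n) _ (wedge e) (wedge_is_linear e).

Lemma iprod_is_linear v : linear (@iprod F n v).
Proof.
move=> a w1 w2; rewrite /iprod scaler_sumr -big_split; apply: eq_bigr => A _.
rewrite scaler_sumr -big_split; apply: eq_bigr => i _ /=.
by rewrite scalerA -scalerDl ffunE /= extZE; congr (_ *: _); ring.
Qed.
HB.instance Definition _ v :=
  GRing.isLinear.Build F (ext F n) (ext F n) _ (@iprod F n v) (iprod_is_linear v).

Lemma wedge_dx1E i w B :
  wedge (dx F [set i]) w B = if i \in B then ins_sign i B * w (B :\ i) else 0.
Proof.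
rewrite /wedge ext_sumE (bigD1 [set i]) //= [X in _ + X]big1 ?addr0; last first.
  move=> A nA; rewrite ext_sumE big1 // => C _.
  by rewrite extZE dxE (negbTE nA) mulr0 !mul0r.
rewrite ext_sumE; case: ifP => iB; last first.
  rewrite big1 // => C _; rewrite extZE !dxE eqxx.
  by case: eqP => [eB|_]; [rewrite eB !inE eqxx in iB | rewrite mulr0].
rewrite (bigD1 (B :\ i)) /=; last by rewrite finset.disjoints1 !inE eqxx.
rewrite extZE !dxE finset.setD1K // !eqxx big1 ?addr0.
  rewrite mulr1 mulr1 /shuffle_sign; congr (_ * _).
  rewrite -ins_sign_self /ins_sign; congr (_ ^+ _).
  have inj_p : injective (fun a : 'I_n => (i, a)) by move=> a b [].
  rewrite -(card_imset _ inj_p); apply: eq_card => -[a b]; rewrite !inE /=.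
  apply/andP/imsetP => [[/andP[/eqP-> bB] lt]|[c]]; first by exists b; rewrite ?inE ?bB.
  by rewrite !inE => cB [-> ->]; rewrite eqxx; case/andP: cB => -> ->.
move=> C /andP[dC nC]; rewrite extZE !dxE; case: eqP => [eB|_]; last by rewrite mulr0.
by case/eqP: nC; rewrite eB finset.setU1K // -finset.disjoints1.
Qed.

Lemma iprodE (v : 'rV[F]_n) w B :
  iprod v w B = \sum_(i | i \notin B) v 0 i * ins_sign i B * w (i |: B).
Proof.
rewrite /iprod ext_sumE.
under eq_bigr => A _ do rewrite ext_sumE big_mkcond.
rewrite exchange_big [RHS]big_mkcond; apply: eq_bigr => i _.
rewrite -big_mkcond /=.
case: ifP => iB; last first.
  rewrite big1 // => A iA; rewrite extZE dxE; case: eqP => [eB|_]; last by rewrite mulr0.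
  by move: iB; rewrite eB !inE eqxx.
rewrite (bigD1 (i |: B)) /=; last by rewrite finset.setU11.
rewrite extZE dxE finset.setU1K // eqxx mulr1 -/(ins_sign i (i |: B)) ins_sign_selfU big1 ?addr0.
  by congr (_ * _); rewrite mulrC.
move=> A /andP[iA nA]; rewrite extZE dxE; case: eqP => [eB|_]; last by rewrite mulr0.
by case/eqP: nA; rewrite eB finset.setD1K.
Qed.

End ExteriorAlgebra.

Section Anticommutation.
Variables (F : fieldType) (n : nat).
Implicit Types (w e : ext F n) (A B C : {set 'I_n}) (i j : 'I_n).
Implicit Types (xi u : 'rV[F]_n).

Lemma wedge_sumr (I : Type) (r : seq I) (P : pred I) e (f : I -> ext F n) :
  wedge e (\sum_(i <- r | P i) f i) = \sum_(i <- r | P i) wedge e (f i).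
Proof. exact: (linear_sum (wedge e)). Qed.

Lemma iprod_sumr (I : Type) (r : seq I) (P : pred I) u (f : I -> ext F n) :
  iprod u (\sum_(i <- r | P i) f i) = \sum_(i <- r | P i) iprod u (f i).
Proof. exact: (linear_sum (@iprod F n u)). Qed.

Lemma iprodZr u (a : F) w : iprod u (a *: w) = a *: iprod u w.
Proof. by rewrite linearZ. Qed.

Lemma iprodDr u w1 w2 : iprod u (w1 + w2) = iprod u w1 + iprod u w2.
Proof. exact: (linearD (@iprod F n u)). Qed.

Lemma wedge0r e : wedge e 0 = 0.
Proof. exact: (linear0 (wedge e)). Qed.

Lemma iprod_deltaE j w B :
  iprod (delta_mx 0 j) w B = if j \in B then 0 else ins_sign F j B * w (j |: B).
Proof.
rewrite iprodE; case: ifP => jB.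
  rewrite big1 // => i iB; rewrite mxE eqxx /=; case: eqP => [ei|_]; last by rewrite !mul0r.
  by rewrite ei jB in iB.
rewrite (bigD1 j) ?jB //= mxE !eqxx mul1r big1 ?addr0 // => i /andP[_ /negbTE ni].
by rewrite mxE ni andbF !mul0r.
Qed.

Lemma iprod_sum (u : 'rV[F]_n) w : iprod u w = \sum_j u 0 j *: iprod (delta_mx 0 j) w.
Proof.
apply/ffunP => B; rewrite iprodE ext_sumE big_mkcond; apply: eq_bigr => j _.
by rewrite extZE iprod_deltaE; case: (j \in B); rewrite ?mulr0 ?mulrA.
Qed.

Lemma wedge_covec_sum (xi : 'rV[F]_n) w :
  wedge (covec xi) w = \sum_i xi 0 i *: wedge (dx F [set i]) w.
Proof. by rewrite /covec wedge_suml; apply: eq_bigr => i _; rewrite wedgeZl. Qed.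

Lemma dx_covec i : dx F [set i] = covec (delta_mx 0 i).
Proof.
rewrite /covec (bigD1 i) //= mxE !eqxx scale1r big1 ?addr0 // => j /negbTE nj.
by rewrite mxE nj andbF scale0r.
Qed.

Lemma signs_lt i j : i != j -> (-1) ^+ (j < i)%N = - (-1) ^+ (i < j)%N :> F.
Proof.
move=> nij; have [ij|ji|/val_inj eij] := ltngtP i j.
- by rewrite expr0 expr1 opprK.
- by rewrite expr0 expr1.
- by rewrite eij eqxx in nij.
Qed.

Lemma anticomm_dx i j w :
  wedge (dx F [set i]) (wedge (dx F [set j]) w) =
  - wedge (dx F [set j]) (wedge (dx F [set i]) w).
Proof.
apply/ffunP => B; rewrite !wedge_dx1E [RHS]ffunE !wedge_dx1E !inE.
have [->|nij] := eqVneq i j.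
  by rewrite ?eqxx /=; case: ifP => _; rewrite ?mulr0 oppr0.
case: ifP => iB /=; last by case: ifP; rewrite ?mulr0 oppr0.
case: ifP => jB /=; last by rewrite mulr0 oppr0.
rewrite !ins_signD1 iB jB /= (signs_lt nij).
have -> : B :\ i :\ j = B :\ j :\ i by apply/setP => a; rewrite !inE andbCA.
ring.
Qed.

Lemma anticomm_idelta i j w :
  iprod (delta_mx 0 i) (iprod (delta_mx 0 j) w) =
  - iprod (delta_mx 0 j) (iprod (delta_mx 0 i) w).
Proof.
apply/ffunP => B; rewrite !iprod_deltaE [RHS]ffunE !iprod_deltaE !inE.
have [->|nij] := eqVneq i j.
  by rewrite ?eqxx /=; case: ifP => _; rewrite ?mulr0 oppr0.
case: ifP => iB /=; first by case: ifP; rewrite ?mulr0 oppr0.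
case: ifP => jB /=; first by rewrite mulr0 oppr0.
rewrite !ins_signU1 iB jB /= (signs_lt nij).
have -> : j |: (i |: B) = i |: (j |: B) by apply/setP => a; rewrite !inE orbCA.
ring.
Qed.

Lemma anticomm_dx_idelta i j w :
  wedge (dx F [set i]) (iprod (delta_mx 0 j) w) +
  iprod (delta_mx 0 j) (wedge (dx F [set i]) w) = (i == j)%:R *: w.
Proof.
apply/ffunP => B; rewrite ffunE /= wedge_dx1E !iprod_deltaE wedge_dx1E extZE !inE.
have [->|nij] := eqVneq i j.
  rewrite ?eqxx /= mul1r; case: ifP => jB.
    by rewrite ins_sign_self mulrA ins_sign_sq mul1r finset.setD1K // addr0.
  by rewrite ins_sign_selfU mulrA ins_sign_sq mul1r finset.setU1K ?jB // add0r.
rewrite mul0r; case: ifP => iB /=; last by case: ifP; rewrite ?mulr0 add0r.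
case: ifP => jB /=; first by rewrite mulr0 add0r.
rewrite !ins_signU1 ins_signD1 iB jB /= (signs_lt nij).
have -> : j |: (B :\ i) = (j |: B) :\ i.
  by apply/setP => a; rewrite !inE; case: eqP => // ->; rewrite eq_sym nij.
ring.
Qed.

Lemma anticomm_covec xi1 xi2 w :
  wedge (covec xi1) (wedge (covec xi2) w) = - wedge (covec xi2) (wedge (covec xi1) w).
Proof.
have dbl x1 x2 : wedge (covec x1) (wedge (covec x2) w) = \sum_i \sum_j
    (x1 0 i * x2 0 j) *: wedge (dx F [set i]) (wedge (dx F [set j]) w).
  rewrite wedge_covec_sum; apply: eq_bigr => i _; rewrite wedge_covec_sum wedge_sumr scaler_sumr.
  by apply: eq_bigr => j _; rewrite wedgeZr scalerA.
rewrite !dbl exchange_big -sumrN; apply: eq_bigr => j _; rewrite -sumrN; apply: eq_bigr => i _.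
by rewrite anticomm_dx scalerN mulrC.
Qed.

Lemma anticomm_iprod u1 u2 w : iprod u1 (iprod u2 w) = - iprod u2 (iprod u1 w).
Proof.
have dbl u v : iprod u (iprod v w) = \sum_i \sum_j
    (u 0 i * v 0 j) *: iprod (delta_mx 0 i) (iprod (delta_mx 0 j) w).
  rewrite iprod_sum; apply: eq_bigr => i _; rewrite [iprod v w]iprod_sum iprod_sumr scaler_sumr.
  by apply: eq_bigr => j _; rewrite iprodZr scalerA.
rewrite !dbl exchange_big -sumrN; apply: eq_bigr => j _; rewrite -sumrN; apply: eq_bigr => i _.
by rewrite anticomm_idelta scalerN mulrC.
Qed.

(** This relation makes the symbol of the Laplacian a scalar: it is the sum of
    the two orders of composing the symbols of d and of delta_v. *)
Lemma anticomm_covec_iprod xi u w :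
  wedge (covec xi) (iprod u w) + iprod u (wedge (covec xi) w) = (xi *m u^T) 0 0 *: w.
Proof.
have -> : wedge (covec xi) (iprod u w) = \sum_i \sum_j
    (xi 0 i * u 0 j) *: wedge (dx F [set i]) (iprod (delta_mx 0 j) w).
  rewrite wedge_covec_sum; apply: eq_bigr => i _.
  by rewrite iprod_sum wedge_sumr scaler_sumr; apply: eq_bigr => j _; rewrite wedgeZr scalerA.
have -> : iprod u (wedge (covec xi) w) = \sum_i \sum_j
    (xi 0 i * u 0 j) *: iprod (delta_mx 0 j) (wedge (dx F [set i]) w).
  rewrite iprod_sum [RHS]exchange_big; apply: eq_bigr => j _.
  rewrite wedge_covec_sum iprod_sumr scaler_sumr; apply: eq_bigr => i _.
  by rewrite iprodZr scalerA mulrC.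
rewrite -big_split mxE scaler_suml; apply: eq_bigr => i _.
rewrite -big_split /= (bigD1 i) //= -scalerDr anticomm_dx_idelta eqxx scale1r mxE big1 ?addr0 //.
by move=> j /negbTE nji; rewrite -scalerDr anticomm_dx_idelta eq_sym nji scale0r scaler0.
Qed.

Lemma deg_sign_is_linear : linear (@deg_sign F n).
Proof. by move=> a w1 w2; apply/ffunP => A; rewrite !ffunE /= /GRing.scale /=; ring. Qed.
HB.instance Definition _ :=
  GRing.isLinear.Build F (ext F n) (ext F n) _ (@deg_sign F n) deg_sign_is_linear.

Lemma deg_sign_dx i w :
  deg_sign (wedge (dx F [set i]) w) = - wedge (dx F [set i]) (deg_sign w).
Proof.
apply/ffunP => B; rewrite !ffunE !wedge_dx1E; case: ifP => iB; last by rewrite mulr0 oppr0.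
by rewrite ffunE (cardsD1 i B) iB exprS; ring.
Qed.

(** Identities between linear maps need only be checked on 1 and carried through
    the operators of wedging with dx^i, which generate all forms. *)
Lemma ext_ind (P : ext F n -> Prop) :
  (forall a w1 w2, P w1 -> P w2 -> P (a *: w1 + w2)) ->
  P (dx F finset.set0) -> (forall i w, P w -> P (wedge (dx F [set i]) w)) -> forall w, P w.
Proof.
move=> Plin P1 PE w.
have P0 : P 0 by rewrite -(addNr (dx F finset.set0)) -scaleN1r; exact: Plin.
suff Pdx B : P (dx F B).
  rewrite (ext_dx w); elim/big_ind: _ => // [w1 w2 p1 p2|B _].
    by rewrite -[w1]scale1r; apply: Plin.
  by rewrite -[X in P X]addr0; apply: Plin.
have [m] := ubnP #|B|; elim: m B => // m IH B ltB.
have [->//|[i iB]] := set_0Vmem B.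
have -> : dx F B = ins_sign F i B *: wedge (dx F [set i]) (dx F (B :\ i)).
  apply/ffunP => C; rewrite extZE wedge_dx1E !dxE.
  case: ifP => iC; last by case: eqP => [eC|_]; [rewrite eC iB in iC | rewrite mulr0].
  have -> : (C :\ i == B :\ i) = (C == B).
    apply/eqP/eqP => [eCB|->//]; by rewrite -(finset.setD1K iC) eCB finset.setD1K.
  by case: eqP => [->|_]; rewrite ?mulr0 // mulr1 ins_sign_sq.
rewrite -[X in P X]addr0; apply: Plin => //; apply: PE; apply: IH.
by rewrite (cardsD1 i) iB add1n ltnS in ltB.
Qed.

End Anticommutation.

Section ExteriorPower.
Variables (F : numFieldType) (n : nat).
Implicit Types (w e : ext F n) (A B C : {set 'I_n}) (i j : 'I_n).
Implicit Types (xi u v : 'rV[F]_n) (P Q : 'M[F]_n).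

Lemma wedge_covec_sq xi w : wedge (covec xi) (wedge (covec xi) w) = 0.
Proof.
have h := anticomm_covec xi xi w; apply/ffunP => B; rewrite ffunE.
by move/ffunP/(_ B): h; rewrite [RHS]ffunE => /eqP; rewrite eq_sym eqNr => /eqP.
Qed.

Lemma iprod_sq u w : iprod u (iprod u w) = 0.
Proof.
have h := anticomm_iprod u u w; apply/ffunP => B; rewrite ffunE.
by move/ffunP/(_ B): h; rewrite [RHS]ffunE => /eqP; rewrite eq_sym eqNr => /eqP.
Qed.

Definition rows_wedge P (s : seq 'I_n) : ext F n :=
  \big[@wedge F n/dx F finset.set0]_(c <- s) covec (row c P).

(** The exterior power of the linear map sending dx^c to row c of P.  Raising all
    indices with a metric is the exterior power of its inverse. *)
Definition ext_pow P w : ext F n := \sum_C w C *: rows_wedge P (enum C).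

Lemma rows_wedge_cons P c s :
  rows_wedge P (c :: s) = wedge (covec (row c P)) (rows_wedge P s).
Proof. by rewrite /rows_wedge big_cons. Qed.

Lemma rows_wedge_insert P i s1 s2 :
  wedge (covec (row i P)) (rows_wedge P (s1 ++ s2)) =
  (-1) ^+ size s1 *: rows_wedge P (s1 ++ i :: s2).
Proof.
elim: s1 => [|c s1 IH] /=; first by rewrite scale1r rows_wedge_cons.
by rewrite !rows_wedge_cons anticomm_covec IH wedgeZr exprS mulN1r scaleNr.
Qed.

Lemma ltn_ord_trans : transitive (fun a b : 'I_n => (a < b)%N).
Proof. by move=> a b c; apply: ltn_trans. Qed.

Lemma ltn_ord_irr : irreflexive (fun a b : 'I_n => (a < b)%N).
Proof. by move=> a; apply: ltnn. Qed.

Lemma enum_sorted C : sorted (fun a b : 'I_n => (a < b)%N) (enum C).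
Proof.
rewrite /enum_mem; apply: sorted_filter; first exact: ltn_ord_trans.
by have := iota_ltn_sorted 0 n; rewrite -val_enum_ord sorted_map enumT.
Qed.

(** The elements less than i come first in both enumerations, and their number
    is the exponent in [ins_sign i C]. *)
Lemma enum_split i C : i \notin C ->
  enum C = [seq c : 'I_n <- enum C | (c < i)%N] ++ [seq c : 'I_n <- enum C | (i < c)%N] /\
  enum (i |: C) = [seq c : 'I_n <- enum C | (c < i)%N] ++ i :: [seq c : 'I_n <- enum C | (i < c)%N].
Proof.
move=> iC; have tr := ltn_ord_trans; have sC := enum_sorted C.
have pw (p : pred 'I_n) : pairwise (fun a b : 'I_n => (a < b)%N) [seq c : 'I_n <- enum C | p c].
  by rewrite -(sorted_pairwise tr); apply: sorted_filter.
have memf (p : pred 'I_n) a : (a \in [seq c : 'I_n <- enum C | p c]) = p a && (a \in C).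
  by rewrite mem_filter mem_enum.
split; apply: (irr_sorted_eq tr ltn_ord_irr).
- exact: enum_sorted.
- rewrite (sorted_pairwise tr) pairwise_cat !pw /= andbT.
  apply/allrelP => a b; rewrite !memf => /andP[ai _] /andP[ib _]; exact: ltn_trans ib.
- move=> a; rewrite mem_cat !memf mem_enum -andb_orl -neq_ltn.
  by case: eqP => // /val_inj ->; rewrite (negbTE iC).
- exact: enum_sorted.
- rewrite (sorted_pairwise tr) pairwise_cat pairwise_cons !pw /= !andbT; apply/andP; split.
    apply/allrelP => a b; rewrite inE !memf => /andP[ai _].
    by case/predU1P => [->//|/andP[ib _]]; exact: ltn_trans ib.
  by apply/allP => b; rewrite memf => /andP[].
- move=> a; rewrite mem_cat inE !memf mem_enum !inE orbCA -andb_orl -neq_ltn.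
  by case: eqP => // /eqP; rewrite -val_eqE => ->.
Qed.

Lemma ext_pow_is_linear P : linear (ext_pow P).
Proof.
move=> a w1 w2; rewrite /ext_pow scaler_sumr -big_split; apply: eq_bigr => C _ /=.
by rewrite scalerA -scalerDl ffunE /= extZE.
Qed.
HB.instance Definition _ P :=
  GRing.isLinear.Build F (ext F n) (ext F n) _ (ext_pow P) (ext_pow_is_linear P).

Lemma ext_powD P w1 w2 : ext_pow P (w1 + w2) = ext_pow P w1 + ext_pow P w2.
Proof. exact: (linearD (ext_pow P)). Qed.

Lemma ext_powZ P (a : F) w : ext_pow P (a *: w) = a *: ext_pow P w.
Proof. by rewrite linearZ. Qed.

Lemma ext_powN P w : ext_pow P (- w) = - ext_pow P w.
Proof. exact: (linearN (ext_pow P)). Qed.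

Lemma ext_pow_sum (I : Type) (r : seq I) (p : pred I) P (f : I -> ext F n) :
  ext_pow P (\sum_(i <- r | p i) f i) = \sum_(i <- r | p i) ext_pow P (f i).
Proof. exact: (linear_sum (ext_pow P)). Qed.

Lemma ext_pow_dx P C : ext_pow P (dx F C) = rows_wedge P (enum C).
Proof.
rewrite /ext_pow (bigD1 C) //= dxE eqxx scale1r big1 ?addr0 // => A /negbTE nA.
by rewrite dxE nA scale0r.
Qed.

Lemma ext_pow1 P : ext_pow P (dx F finset.set0) = dx F finset.set0.
Proof. by rewrite ext_pow_dx enum_set0 /rows_wedge big_nil. Qed.

(** If i occurs in C, both sides vanish because covectors square to zero.
    Otherwise, moving row i of P past the rows with smaller index costs the same
    sign as moving dx^i past the dx^c. *)
Lemma ext_pow_wedge_dx P i w :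
  ext_pow P (wedge (dx F [set i]) w) = wedge (covec (row i P)) (ext_pow P w).
Proof.
suff hdx C : ext_pow P (wedge (dx F [set i]) (dx F C)) =
    wedge (covec (row i P)) (ext_pow P (dx F C)).
  rewrite [w]ext_dx wedge_sumr !ext_pow_sum wedge_sumr.
  by apply: eq_bigr => C _; rewrite wedgeZr !ext_powZ wedgeZr hdx.
rewrite [in RHS]ext_pow_dx; have [iC|iC] := boolP (i \in C).
  have -> : wedge (dx F [set i]) (dx F C) = 0.
    apply/ffunP => B; rewrite wedge_dx1E [RHS]ffunE; case: ifP => // _.
    by rewrite dxE; case: eqP => [eC|_]; [rewrite -eC !inE eqxx in iC | rewrite mulr0].
  have iCi : i \notin C :\ i by rewrite !inE eqxx.
  have [e1] := enum_split iCi; rewrite finset.setD1K // => ->.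
  have := rows_wedge_insert P i [seq c : 'I_n <- enum (C :\ i) | (c < i)%N]
    [seq c : 'I_n <- enum (C :\ i) | (i < c)%N].
  move/(congr1 (fun z => wedge (covec (row i P)) z)); rewrite wedge_covec_sq wedgeZr.
  move/esym/eqP; rewrite scaler_eq0 signr_eq0 /= => /eqP ->.
  exact: (linear0 (ext_pow P)).
have [e1 e2] := enum_split iC; rewrite e1 rows_wedge_insert -e2 -ext_pow_dx -ext_powZ.
congr (ext_pow P _); apply/ffunP => B; rewrite wedge_dx1E extZE !dxE.
have -> : size [seq c : 'I_n <- enum C | (c < i)%N] = #|[set a in C | (a < i)%N]|.
  have /card_uniqP <- : uniq [seq c : 'I_n <- enum C | (c < i)%N] by rewrite filter_uniq ?enum_uniq.
  by apply: eq_card => a; rewrite [LHS]mem_filter mem_enum inE andbC.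
case: ifP => iB; last first.
  by case: eqP => [eB|_]; [rewrite eB !inE eqxx in iB | rewrite mulr0].
have -> : (B :\ i == C) = (B == i |: C).
  by apply/eqP/eqP => [<-|->]; rewrite ?finset.setD1K ?finset.setU1K.
by case: eqP => [->|_]; rewrite ?mulr0 // -/(ins_sign F i (i |: C)) ins_sign_selfU.
Qed.

Lemma iprod_dx0 u : iprod u (dx F finset.set0) = 0.
Proof.
apply/ffunP => B; rewrite iprodE [RHS]ffunE big1 // => i _.
rewrite dxE; case: eqP => [/setP/(_ i)|_]; last by rewrite mulr0.
by rewrite !inE eqxx.
Qed.

(** Naturality of the interior product: contraction anticommutes past the
    generators in the same way on both sides. *)
Lemma iprod_ext_pow P u w : iprod u (ext_pow P w) = ext_pow P (iprod (u *m P^T) w).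
Proof.
elim/ext_ind: w => [a w1 w2 h1 h2||i w IH].
- by rewrite ext_powD ext_powZ !iprodDr !iprodZr h1 h2 ext_powD ext_powZ.
- by rewrite ext_pow1 !iprod_dx0 (linear0 (ext_pow P)).
rewrite ext_pow_wedge_dx.
have := anticomm_covec_iprod (row i P) u (ext_pow P w).
move/(canRL (addKr _)) => ->; rewrite IH -ext_pow_wedge_dx.
have := anticomm_covec_iprod (delta_mx 0 i) (u *m P^T) w; rewrite -dx_covec.
move/(canRL (addKr _)) => ->; rewrite ext_powD ext_powN ext_powZ; congr (_ + _ *: _).
by rewrite trmx_mul trmxK mulmxA -rowE.
Qed.

Lemma ext_powK P Q : Q *m P = 1%:M -> cancel (ext_pow Q) (ext_pow P).
Proof.
move=> QP w; elim/ext_ind: w => [a w1 w2 h1 h2||i w IH].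
- by rewrite !ext_powD !ext_powZ h1 h2.
- by rewrite !ext_pow1.
have covecP xi z : ext_pow P (wedge (covec xi) z) = wedge (covec (xi *m P)) (ext_pow P z).
  rewrite wedge_covec_sum ext_pow_sum.
  transitivity (\sum_j xi 0 j *: wedge (covec (row j P)) (ext_pow P z)).
    by apply: eq_bigr => j _; rewrite ext_powZ ext_pow_wedge_dx.
  rewrite [RHS]wedge_covec_sum; under eq_bigr => j _ do rewrite wedge_covec_sum scaler_sumr.
  rewrite exchange_big; apply: eq_bigr => k _; rewrite mxE scaler_suml.
  by apply: eq_bigr => j _; rewrite mxE scalerA.
by rewrite ext_pow_wedge_dx covecP IH -row_mul QP row1 dx_covec.
Qed.

Lemma ext_pow_deg_sign P w : ext_pow P (deg_sign w) = deg_sign (ext_pow P w).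
Proof.
have ds_covec xi z : deg_sign (wedge (covec xi) z) = - wedge (covec xi) (deg_sign z).
  rewrite !wedge_covec_sum (linear_sum (@deg_sign F n)) -sumrN; apply: eq_bigr => i _.
  by rewrite linearZ /= deg_sign_dx scalerN.
elim/ext_ind: w => [a w1 w2 h1 h2||i w IH].
- rewrite (linearP (@deg_sign F n)) !(linearP (ext_pow P)) (linearP (@deg_sign F n)) /=.
  by rewrite h1 h2.
- have ds1 : deg_sign (dx F finset.set0) = dx F finset.set0 :> ext F n.
    apply/ffunP => B; rewrite ffunE dxE; case: eqP => [->|_]; rewrite ?mulr0 //.
    by rewrite cards0 mulr1.
  by rewrite ds1 ext_pow1 ds1.
by rewrite deg_sign_dx ext_powN !ext_pow_wedge_dx IH ds_covec.
Qed.

Lemma lfinvE (f : {linear ext F n -> ext F n}) (f' : ext F n -> ext F n) w :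
  cancel f f' -> cancel f' f -> lfinv f w = f' w.
Proof.
move=> fK f'K; rewrite -{1}[w]f'K /lfinv -(lfunE f) lker0_lfunK //.
by apply/lker0P => w1 w2; rewrite !lfunE => /(can_inj fK).
Qed.

End ExteriorPower.

(** * Positive definite matrices *)

Section PositiveDefinite.
Variables (R : realType) (n : nat).
Implicit Types (G : 'M[R]_n) (u : 'rV[R]_n).

Definition posdef G : Prop := forall u, u != 0 -> 0 < (u *m G *m u^T) 0 0.

Lemma posdef_unit G : posdef G -> G \in unitmx.
Proof.
move=> pG; rewrite -row_free_unit -kermx_eq0; apply/negPn/negP => nz.
have [i ri] : exists i, row i (kermx G) != 0.
  apply/existsP; apply: contraNT nz; rewrite negb_exists => /forallP r0.
  by apply/eqP/row_matrixP => i; rewrite row0; apply/eqP; move: (r0 i); rewrite negbK.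
have := pG _ ri; rewrite -row_mul mulmx_ker row0 mul0mx mxE ltxx //.
Qed.

Lemma dotv_ge0 u : 0 <= (u *m u^T) 0 0.
Proof. by rewrite mxE sumr_ge0 // => i _; rewrite mxE -expr2 sqr_ge0. Qed.

Lemma dotv_gt0 u : u != 0 -> 0 < (u *m u^T) 0 0.
Proof.
move=> nz; rewrite lt0r dotv_ge0 andbT; apply: contra nz => /eqP.
rewrite mxE => /eqP; rewrite psumr_eq0 => [/allP u0|i _]; last by rewrite mxE -expr2 sqr_ge0.
apply/eqP/rowP => j; rewrite mxE; apply/eqP.
by move: (u0 j (mem_index_enum _)); rewrite mxE -expr2 sqrf_eq0.
Qed.

(** The segment from the identity to G consists of positive definite, hence
    invertible matrices, so the determinant has no zero along it. *)
Lemma posdef_det G : posdef G -> 0 < \det G.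
Proof.
move=> pG; rewrite ltNge; apply/negP => le0.
pose p : {poly R} := \det (\matrix_(i, j) ((1 - 'X) * (i == j)%:R%:P + 'X * (G i j)%:P)).
have pE t : p.[t] = \det ((1 - t) *: 1%:M + t *: G).
  rewrite /p -horner_evalE -det_map_mx; congr (\det _); apply/matrixP => i j.
  by rewrite !mxE /= horner_evalE !hornerE.
have p0 : (- p).[0] <= 0 by rewrite hornerN pE subr0 scale1r scale0r addr0 det1 oppr_le0.
have p1 : 0 <= (- p).[1] by rewrite hornerN pE subrr scale0r scale1r add0r oppr_ge0.
have [t /andP[t0 t1] /rootP] : exists2 t, 0 <= t <= 1 & root (- p) t.
  by have [t] := @poly_ivt _ (- p) 0 1 ler01 (introT andP (conj p0 p1)); exists t.
rewrite hornerN => /eqP; rewrite oppr_eq0 pE => /eqP dt0.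
have : posdef ((1 - t) *: 1%:M + t *: G).
  move=> u nz; rewrite mulmxDr mulmxDl mxE -!scalemxAr mulmx1 -!scalemxAl.
  rewrite [X in X + _]mxE [X in _ + X]mxE.
  have := dotv_gt0 nz; have := pG u nz; move: t0; rewrite le0r => /orP[/eqP->|t0].
    by move=> _ h; rewrite mul0r addr0 subr0 mul1r.
  move=> h1 h2; rewrite ltr_wpDl // ?mulr_gt0 // mulr_ge0 ?subr_ge0 //; exact: ltW.
by move/posdef_unit; rewrite unitmxE dt0 unitr0.
Qed.

Lemma posdef_inv G : G^T = G -> posdef G -> posdef (invmx G).
Proof.
move=> sG pG u nz; have uG := posdef_unit pG.
have nz' : u *m invmx G != 0.
  by apply: contra nz => /eqP e; rewrite -[u](mulmxKV uG) e mul0mx.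
by have := pG _ nz'; rewrite mulmxKV // trmx_mul trmx_inv sG mulmxA.
Qed.

End PositiveDefinite.

(** * The Hodge star and the twist by the vector field *)

Section Twist.
Variables (F : numFieldType) (n : nat).
Implicit Types (w : ext F n) (xi v : 'rV[F]_n) (G : 'M[F]_n).

(** The cometric that induces the inner product <T_v ., .> on forms. *)
Definition cometric G v : 'M[F]_n := invmx G + v^T *m v.

Definition sqnorm G v : F := (flat G v *m v^T) 0 0.

Definition Tinv G v w : ext F n :=
  w - (1 + sqnorm G v)^-1 *: wedge (covec (flat G v)) (iprod v w).

Lemma Tmap_is_linear G v : linear (@Tmap F n G v).
Proof.
by move=> a w1 w2; rewrite /Tmap iprodDr iprodZr wedgeDr wedgeZr scalerDr addrACA.
Qed.
HB.instance Definition _ G v :=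
  GRing.isLinear.Build F (ext F n) (ext F n) _ (@Tmap F n G v) (Tmap_is_linear G v).

(** For xi = v^flat, this makes the inverse of T_v a combination of the identity
    and v^flat /\ i_v. *)
Lemma wedge_iprod_sq xi v w :
  wedge (covec xi) (iprod v (wedge (covec xi) (iprod v w))) =
  (xi *m v^T) 0 0 *: wedge (covec xi) (iprod v w).
Proof.
have := anticomm_covec_iprod xi v (iprod v w); rewrite iprod_sq wedge0r add0r => ->.
by rewrite wedgeZr.
Qed.

Lemma TmapK G v : 1 + sqnorm G v != 0 -> cancel (@Tmap F n G v) (Tinv G v).
Proof.
move=> nz w; rewrite /Tinv /Tmap iprodDr wedgeDr wedge_iprod_sq -/(sqnorm G v).
by rewrite -[X in _ *: (X + _)]scale1r -scalerDl scalerA mulVf // scale1r addrK.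
Qed.

Lemma TinvK G v : 1 + sqnorm G v != 0 -> cancel (Tinv G v) (@Tmap F n G v).
Proof.
move=> nz w; rewrite /Tinv /Tmap -scaleNr iprodDr iprodZr wedgeDr wedgeZr wedge_iprod_sq.
rewrite -/(sqnorm G v) scalerA -addrA -[X in _ + (_ + (X + _))]scale1r -!scalerDl.
by rewrite [X in X *: _](_ : _ = 0) ?scale0r ?addr0 //; field.
Qed.

(** Moving i_(xi g^-1) past v^flat /\ i_v in T_v produces the term xi(v) i_v by
    which the two contractions differ. *)
Lemma Tmap_iprod G v xi w : G^T = G -> G \in unitmx ->
  Tmap G v (iprod (xi *m cometric G v) w) = iprod (xi *m invmx G) (Tmap G v w).
Proof.
move=> symG uG; set J := iprod (xi *m invmx G); set a := (xi *m v^T) 0 0.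
have split_h z : iprod (xi *m cometric G v) z = J z + a *: iprod v z.
  rewrite /J [LHS]iprod_sum [iprod (xi *m _) _]iprod_sum [iprod v z]iprod_sum.
  rewrite scaler_sumr -big_split; apply: eq_bigr => j _ /=.
  rewrite scalerA -scalerDl; congr (_ *: _).
  by rewrite /cometric mulmxDr mxE mulmxA; congr (_ + _); rewrite mxE big_ord1.
have pair : (flat G v *m (xi *m invmx G)^T) 0 0 = a.
  rewrite /flat trmx_mul trmx_inv symG mulmxA mulmxK // /a.
  have -> : v *m xi^T = (xi *m v^T)^T by rewrite trmx_mul trmxK.
  by rewrite mxE.
rewrite /Tmap split_h iprodDr iprodZr iprod_sq scaler0 addr0 [RHS]iprodDr -/J.
have := anticomm_covec_iprod (flat G v) (xi *m invmx G) (iprod v w); rewrite pair -/J.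
move/(canRL (addKr _)) => ->.
rewrite (anticomm_iprod v (xi *m invmx G)) -/J -[in LHS]scaleN1r wedgeZr scaleN1r.
by rewrite addrCA [in RHS]addrC -!addrA; congr (_ + _); rewrite addrC.
Qed.

End Twist.

Section Hodge.
Variables (R : realType) (n : nat).
Implicit Types (w : ext R n) (xi v : 'rV[R]_n) (G : 'M[R]_n) (s : R) (B : {set 'I_n}).

Definition vol s G : R := s * Num.sqrt (\det G).

(** The star is the exterior power of G^-1 followed by taking complements with
    signs, so it inherits invertibility and commutation rules from both. *)
Lemma hodgeE s G w B :
  hodge s G w B = shuffle_sign R (~: B)%SET B * ext_pow (invmx G) w (~: B)%SET * vol s G.
Proof.
rewrite ffunE; congr (_ * _ * _).
rewrite /inner (bigD1 (~: B)%SET) //= dxE eqxx mul1r big1 ?addr0 // => A /negbTE nA.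
by rewrite dxE nA mul0r.
Qed.

Lemma hodge_is_linear s G : linear (@hodge R n s G).
Proof.
move=> a w1 w2; apply/ffunP => B; rewrite hodgeE ffunE /= extZE !hodgeE.
rewrite ext_powD ext_powZ ffunE /= extZE; ring.
Qed.
HB.instance Definition _ s G :=
  GRing.isLinear.Build R (ext R n) (ext R n) _ (@hodge R n s G) (hodge_is_linear s G).

Definition hodge_inv s G w : ext R n := ext_pow G
  [ffun A : {set 'I_n} => shuffle_sign R A (~: A)%SET * w (~: A)%SET / vol s G].

Lemma shuffle_sign_sq A B : shuffle_sign R A B * shuffle_sign R A B = 1 :> R.
Proof. by rewrite -expr2 sqrr_sign. Qed.

Lemma hodgeK s G : G \in unitmx -> vol s G != 0 -> cancel (hodge s G) (hodge_inv s G).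
Proof.
move=> uG nz w; rewrite /hodge_inv -[RHS](ext_powK (mulVmx uG)); congr (ext_pow G _).
apply/ffunP => A; rewrite ffunE hodgeE finset.setCK.
by rewrite mulrA mulfK // mulrA shuffle_sign_sq mul1r.
Qed.

Lemma hodge_invK s G : G \in unitmx -> vol s G != 0 -> cancel (hodge_inv s G) (hodge s G).
Proof.
move=> uG nz w; apply/ffunP => B; rewrite hodgeE /hodge_inv ext_powK ?mulmxV // ffunE.
by rewrite finset.setCK mulrA divfK // mulrA shuffle_sign_sq mul1r.
Qed.

Lemma card_setX_sum (A B : {set 'I_n}) (r : rel 'I_n) :
  #|[set ab in finset.setX A B | r ab.1 ab.2]%SET| = (\sum_(a in A) \sum_(b in B) r a b)%N.
Proof.
rewrite pair_big /= -sum1_card big_mkcond [RHS]big_mkcond; apply: eq_bigr => -[a b] _.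
by rewrite !inE /=; case: (a \in A); case: (b \in B); case: (r a b).
Qed.

Lemma card_set_sum (A : {set 'I_n}) (p : pred 'I_n) :
  #|[set a in A | p a]%SET| = (\sum_(a in A) p a)%N.
Proof.
rewrite -sum1_card big_mkcond [RHS]big_mkcond; apply: eq_bigr => a _.
by rewrite !inE; case: (a \in A); case: (p a).
Qed.

(** Moving i from one block to the other adds the inversions with the elements of
    B less than i and removes those with the elements of ~: B greater than i. *)
Lemma shuffle_sign_move i B : i \in B ->
  shuffle_sign R (i |: ~: B)%SET (B :\ i) =
  shuffle_sign R (~: B)%SET B * ins_sign R i B * (-1) ^+ #|[set a in ~: B | (i < a)%N]%SET|.
Proof.
move=> iB; rewrite -(ins_sign_self R i B) /ins_sign /shuffle_sign.
rewrite !card_set_sum.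
rewrite !(card_setX_sum _ _ (fun a b => (b < a)%N)) big_setU1 ?inE ?iB //=.
have -> : (\sum_(a in ~: B) \sum_(b in B) (b < a) =
   \sum_(a in ~: B) (i < a)%N + \sum_(a in ~: B) \sum_(b in B :\ i) (b < a))%N.
  by rewrite -big_split; apply: eq_bigr => a _; rewrite (big_setD1 i iB).
rewrite !exprD; set q := (-1) ^+ (\sum_(a in ~: B) (i < a))%N.
have q2 : q * q = 1 by rewrite /q -expr2 sqrr_sign.
by rewrite -[LHS]mul1r -q2; ring.
Qed.

(** For the Euclidean metric this is a comparison of signs between complementary
    index sets; [iprod_ext_pow] carries it over to G. *)
Lemma dx_hodge s G i w : G^T = G ->
  wedge (dx R [set i]) (hodge s G (deg_sign w)) = - hodge s G (iprod (row i (invmx G)) w).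
Proof.
move=> symG; apply/ffunP => B; rewrite wedge_dx1E [RHS]ffunE !hodgeE.
have -> : row i (invmx G) = delta_mx 0 i *m (invmx G)^T by rewrite trmx_inv symG -rowE.
rewrite -iprod_ext_pow iprod_deltaE finset.in_setC ext_pow_deg_sign ffunE.
case: ifP => iB /=; last by rewrite mulr0 mul0r oppr0.
have -> : (~: (B :\ i) = i |: ~: B)%SET.
  by apply/setP => a; rewrite !inE negb_and negbK.
rewrite shuffle_sign_move // cardsU1 !inE iB /=.
have -> : #|~: B|%SET = (#|[set a in ~: B | (a < i)%N]%SET| + #|[set a in ~: B | (i < a)%N]%SET|)%N.
  rewrite !card_set_sum -big_split -sum1_card; apply: eq_bigr => a; rewrite inE => aB /=.
  by case: ltngtP => // /val_inj eai; rewrite eai iB in aB.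
rewrite exprD exprD expr1 -/(ins_sign R i (~: B)%SET).
set sg := (-1) ^+ #|_|; have sg2 : sg * sg = 1 by rewrite /sg -expr2 sqrr_sign.
transitivity (- ((ins_sign R i B * ins_sign R i B) * (sg * sg) * shuffle_sign R (~: B)%SET B *
  (ins_sign R i (~: B)%SET * ext_pow (invmx G) w (i |: ~: B)%SET) * vol s G)); first by ring.
by rewrite ins_sign_sq sg2 !mul1r.
Qed.

End Hodge.

Section CodifferentialSymbol.
Variables (R : realType) (n : nat).
Implicit Types (s : R) (G : 'M[R]_n) (v : 'rV[R]_n) (e w : ext R n).

Lemma sqnorm_ge0 G (u : 'rV[R]_n) : posdef G -> 0 <= sqnorm G u.
Proof.
move=> pG; rewrite /sqnorm /flat; have [->|nz] := eqVneq u 0; last by rewrite ltW ?pG.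
by rewrite !mul0mx mxE.
Qed.

Lemma cometric_sym G (u : 'rV[R]_n) : G^T = G -> (cometric G u)^T = cometric G u.
Proof. by move=> sG; rewrite /cometric linearD /= trmx_mul trmxK trmx_inv sG. Qed.

(** The operator by which d is conjugated to give delta_v: it includes the degree
    sign of the codifferential. *)
Definition star_v s G v e : ext R n := hodge s G (deg_sign (Tmap G v e)).
Definition star_v_inv s G v w : ext R n := Tinv G v (hodge_inv s G w).

Lemma star_v_is_linear s G v : linear (star_v s G v).
Proof.
move=> a w1 w2; rewrite /star_v (linearP (@Tmap R n G v)) (linearP (@deg_sign R n)).
by rewrite (linearP (@hodge R n s G)).
Qed.
HB.instance Definition _ s G v :=
  GRing.isLinear.Build R (ext R n) (ext R n) _ (star_v s G v) (star_v_is_linear s G v).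

Lemma star_v_inv_is_linear s G v : linear (star_v_inv s G v).
Proof.
move=> a w1 w2; rewrite /star_v_inv.
have -> : hodge_inv s G (a *: w1 + w2) = a *: hodge_inv s G w1 + hodge_inv s G w2.
  rewrite /hodge_inv -ext_powZ -ext_powD; congr (ext_pow G _); apply/ffunP => A.
  by rewrite !(extZE, ffunE) /=; ring.
rewrite /Tinv iprodDr iprodZr wedgeDr wedgeZr scalerDr opprD addrACA; congr (_ + _).
by rewrite scalerBr !scalerA mulrC.
Qed.
HB.instance Definition _ s G v :=
  GRing.isLinear.Build R (ext R n) (ext R n) _ (star_v_inv s G v) (star_v_inv_is_linear s G v).

Lemma vol_neq0 s G : posdef G -> s = 1 \/ s = -1 -> vol s G != 0.
Proof.
move=> pG hs; apply: mulf_neq0; last by rewrite gt_eqF // sqrtr_gt0 posdef_det.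
by case: hs => ->; rewrite ?oppr_eq0 oner_eq0.
Qed.

Lemma sqnorm1_neq0 G v : posdef G -> 1 + sqnorm G v != 0.
Proof. by move=> pG; rewrite gt_eqF // ltr_wpDr // sqnorm_ge0. Qed.

(** As delta_v is [star_v_inv] d [star_v], the left-hand side is its principal
    symbol at dx^i. *)
Lemma star_v_symbol s G v i e : G^T = G -> posdef G -> s = 1 \/ s = -1 ->
  star_v_inv s G v (wedge (dx R [set i]%SET) (star_v s G v e)) =
  - iprod (row i (cometric G v)) e.
Proof.
move=> sG pG hs; have uG := posdef_unit pG; have nv := vol_neq0 pG hs.
have nq := sqnorm1_neq0 v pG.
rewrite /star_v dx_hodge // (linearN (star_v_inv s G v)) /= /star_v_inv hodgeK //.
by congr (- _); rewrite !rowE -Tmap_iprod // TmapK.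
Qed.

Lemma codiff_vE (s : 'rV[R]_n -> R) (G : 'rV[R]_n -> 'M[R]_n) (v : 'rV[R]_n -> 'rV[R]_n)
    (w : dform R n) y : posdef (G y) -> s y = 1 \/ s y = -1 ->
  codiff_v s G v w y =
  star_v_inv (s y) (G y) (v y) (ext_d (fun z => star_v (s z) (G z) (v z) (w z)) y).
Proof.
move=> pG hs; have uG := posdef_unit pG; have nv := vol_neq0 pG hs.
have nq := sqnorm1_neq0 (v y) pG.
rewrite /codiff_v (lfinvE (f' := Tinv (G y) (v y))) /=; [|exact: TmapK|exact: TinvK].
rewrite /codiff (lfinvE (f' := hodge_inv (s y) (G y))) //=; [exact: hodgeK|exact: hodge_invK].
Qed.

End CodifferentialSymbol.

(** * One-sided derivatives and functions of class C1 up to the boundary *)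

Section RelativeDerivative.
Local Open Scope classical_set_scope.
Variable (R : realType).
Implicit Types (D : set R) (f g : R -> R) (t l : R).

(** The derivative of f at t through points of D only.  It covers partial
    derivatives at boundary points of the half-space as well as derivatives at
    the end of the half-line. *)
Definition relderiv D f t l : Prop :=
  (fun u => (f u - f t) / (u - t)) @ within D t^' --> l.

Lemma dnbhs_neq_within D t : \forall u \near within D t^', u != t.
Proof. by apply: (@filterS _ (nbhs t) _ setT) => //; exact: filterT. Qed.

Lemma cvg_id_within D t : (fun u : R => u) @ within D t^' --> t.
Proof.
by do 2 apply: cvg_within_filter; exact: cvg_id.
Qed.

Lemma relderiv_eq D f g t l :
  (\forall u \near within D t^', f u = g u) -> f t = g t -> relderiv D f t l -> relderiv D g t l.
Proof.
move=> fg fgt; apply: cvg_trans; apply: near_eq_cvg.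
by near=> u; rewrite fgt; congr ((_ - _) / _); near: u.
Unshelve. all: by end_near. Qed.

Lemma relderiv_cts D f t l : relderiv D f t l -> f @ within D t^' --> f t.
Proof.
move=> df; have : (fun u => (f u - f t) / (u - t) * (u - t) + f t) @ within D t^' -->
    l * (t - t) + f t.
  apply: cvgD; last exact: cvg_cst.
  apply: cvgM => //; apply: cvgB; [exact: cvg_id_within | exact: cvg_cst].
rewrite subrr mulr0 add0r; apply: cvg_trans; apply: near_eq_cvg.
near=> u; rewrite divfK ?subrK // subr_eq0; near: u; exact: dnbhs_neq_within.
Unshelve. all: by end_near. Qed.

Lemma relderiv_cst D t (c : R) : relderiv D (fun=> c) t 0.
Proof.
rewrite /relderiv; under eq_fun do rewrite subrr mul0r; exact: cvg_cst.
Qed.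

Lemma relderiv_id D t : relderiv D id t 1.
Proof.
apply: cvg_trans (@cvg_cst _ (1 : R) _ (within D t^') _); apply: near_eq_cvg.
near=> u; rewrite divff // subr_eq0; near: u; exact: dnbhs_neq_within.
Unshelve. all: by end_near. Qed.

Lemma relderivD D f g t l m :
  relderiv D f t l -> relderiv D g t m -> relderiv D (fun u => f u + g u) t (l + m).
Proof.
move=> df dg; rewrite /relderiv.
under eq_fun do rewrite opprD addrACA mulrDl; exact: cvgD.
Qed.

Lemma relderivM D f g t l m :
  relderiv D f t l -> relderiv D g t m -> relderiv D (fun u => f u * g u) t (l * g t + f t * m).
Proof.
move=> df dg; rewrite /relderiv.
have -> : (fun u => (f u * g u - f t * g t) / (u - t)) =
    (fun u => (f u - f t) / (u - t) * g u + f t * ((g u - g t) / (u - t))).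
  by apply/funext => u; set k := (u - t)^-1; ring.
apply: cvgD; first by apply: cvgM => //; exact: relderiv_cts dg.
by apply: cvgM => //; exact: cvg_cst.
Qed.

(** Continuity of g suffices at a zero of f.  This serves for the zeroth-order
    coefficients of delta_v, which contain derivatives of the metric. *)
Lemma relderivM0 D f g t l : f t = 0 ->
  relderiv D f t l -> g @ within D t^' --> g t -> relderiv D (fun u => f u * g u) t (l * g t).
Proof.
move=> ft df cg; rewrite /relderiv.
have -> : (fun u => (f u * g u - f t * g t) / (u - t)) = (fun u => (f u - f t) / (u - t) * g u).
  by apply/funext => u; rewrite ft mul0r !subr0 mulrAC.
exact: cvgM.
Qed.

Lemma relderivV D f t l : f t != 0 ->
  relderiv D f t l -> relderiv D (fun u => (f u)^-1) t (- l * (f t)^-1 * (f t)^-1).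
Proof.
move=> nz df; rewrite /relderiv.
have cf := relderiv_cts df.
have nzn : \forall u \near within D t^', f u != 0 by apply: (cvgr_neq0 (f t)).
have : (fun u => - ((f u - f t) / (u - t)) * (f u)^-1 * (f t)^-1) @ within D t^' -->
    - l * (f t)^-1 * (f t)^-1.
  apply: cvgM; last exact: cvg_cst.
  by apply: cvgM; [exact: cvgN | exact: cvgV].
apply: cvg_trans; apply: near_eq_cvg; near=> u.
have nzu : f u != 0 by near: u.
rewrite -!mulrA mulNr; set k := (u - t)^-1; field.
by rewrite nz nzu.
Unshelve. all: by end_near. Qed.

Lemma relderiv_sqrt D f t l : 0 < f t ->
  relderiv D f t l -> relderiv D (fun u => Num.sqrt (f u)) t (l / (Num.sqrt (f t) *+ 2)).
Proof.
move=> pos df; rewrite /relderiv.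
have cf := relderiv_cts df.
have csf : (fun u => Num.sqrt (f u)) @ within D t^' --> Num.sqrt (f t).
  by apply: continuous_cvg => //; exact: sqrt_continuous.
have posn : \forall u \near within D t^', 0 < f u by apply: (cvgr_gt (f t)).
have st : 0 < Num.sqrt (f t) by rewrite sqrtr_gt0.
have : (fun u => (f u - f t) / (u - t) / (Num.sqrt (f u) + Num.sqrt (f t))) @ within D t^' -->
    l / (Num.sqrt (f t) *+ 2).
  apply: cvgM => //; apply: cvgV; first by rewrite mulrn_eq0 /= gt_eqF.
  by rewrite mulr2n; apply: cvgD => //; exact: cvg_cst.
apply: cvg_trans; apply: near_eq_cvg; near=> u.
have pu : 0 < f u by near: u.
have su : 0 < Num.sqrt (f u) by rewrite sqrtr_gt0.
rewrite mulrAC; congr (_ * _).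
rewrite -{1}(sqr_sqrtr (ltW pu)) -{1}(sqr_sqrtr (ltW pos)) subr_sqr mulfK //.
by rewrite gt_eqF // addr_gt0.
Unshelve. all: by end_near. Qed.

Lemma is_derive_relderiv D f t l : is_derive t 1 f l -> relderiv D f t l.
Proof.
move=> [df <-]; apply: cvg_within_filter.
have sub : (fun u => u - t) @ t^' --> 0^'.
  move=> P nP; change (nbhs (0 : R) (fun h => h != 0 -> P h)) in nP.
  change (nbhs t (fun u => u != t -> P (u - t))).
  have ct : (fun u => u - t) @ t --> (0 : R).
    by rewrite -(subrr t); apply: cvgB; [exact: cvg_id | exact: cvg_cst].
  have nQ : nbhs t (fun u => u - t != 0 -> P (u - t)) by exact: (ct _ nP).
  by apply: (filterS _ nQ) => u Pu ut; apply: Pu; rewrite subr_eq0.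
have c := cvg_comp _ _ sub df; apply: cvg_trans c; apply: near_eq_cvg; apply: nearW => u /=.
by rewrite /GRing.scale /= mulr1 subrK mulrC.
Qed.

(** Away from the end points relative derivatives are ordinary ones, to which the
    mean value theorem applies. *)
Lemma relderiv_is_derive D f t l : nbhs t D -> relderiv D f t l -> is_derive t 1 f l.
Proof.
move=> nD df.
have c : (fun h : R => h^-1 *: ((f \o shift t) (h *: 1) - f t)) @ 0^' --> l.
  have add : (fun h => h + t) @ 0^' --> within D t^'.
    move=> P nP; change (nbhs t (fun u => u != t -> D u -> P u)) in nP.
    change (nbhs (0 : R) (fun h => h != 0 -> P (h + t))).
    have ct : (fun h => h + t) @ (0 : R) --> t.
      by rewrite -[X in _ --> X]add0r; apply: cvgD; [exact: cvg_id | exact: cvg_cst].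
    have nQ : nbhs (0 : R) (fun h => h + t != t -> D (h + t) -> P (h + t)) by exact: (ct _ nP).
    have nD0 : nbhs (0 : R) (fun h => D (h + t)) by exact: (ct _ nD).
    apply: (filterS _ (filterI nQ nD0)) => h [Ph Dh] h0; apply: Ph => //=.
    by rewrite -subr_eq0 addrK.
  have c := cvg_comp _ _ add df; apply: cvg_trans c; apply: near_eq_cvg; apply: nearW => h /=.
  by rewrite /GRing.scale /= mulr1 addrK mulrC.
by split; [apply/cvg_ex; exists l | apply: cvg_lim].
Qed.

End RelativeDerivative.

Section PartialDerivatives.
Local Open Scope classical_set_scope.
Variables (R : realType) (n : nat).
Implicit Types (f g : 'rV[R]_n -> R) (x : 'rV[R]_n) (i : 'I_n) (l : R).

Definition axis_dom i x : set R := [set h | halfspace (x + h *: delta_mx 0 i)].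

Definition is_pderiv i f x l : Prop :=
  relderiv (axis_dom i x) (fun h => f (x + h *: delta_mx 0 i)) 0 l.

Lemma is_pderivE i f x l : is_pderiv i f x l <-> (diff_quot i f x @ dir_nbhs i x --> l).
Proof.
rewrite /is_pderiv /relderiv (_ : (fun u => _) = diff_quot i f x) //.
by apply/funext => h; rewrite scale0r addr0 subr0 mulrC.
Qed.

Lemma dir_nbhs_proper i x : halfspace x -> ProperFilter (dir_nbhs i x).
Proof.
move=> hx; split; last exact: within_filter.
move=> h; change (nbhs (0 : R) (fun u => u != 0 -> axis_dom i x u -> False)) in h.
move/nbhs_ballP: h => [e e0 he]; have e2 : 0 < e / 2 by rewrite divr_gt0.
apply: (he (e / 2)).
- by rewrite /ball /= sub0r normrN gtr0_norm // ltr_pdivrMr // mulr2n mulrDr mulr1 ltrDl.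
- by rewrite gt_eqF.
move=> j j0; rewrite !mxE eqxx /= addr_ge0 ?hx // mulr_ge0 ?ler0n //.
exact: ltW.
Qed.

Lemma is_pderiv_pderiv i f x l : halfspace x -> is_pderiv i f x l -> pderiv i f x = l.
Proof.
by move=> hx /is_pderivE; have := @dir_nbhs_proper i x hx => ? ?; apply: cvg_lim.
Qed.

(** Carries continuity on the half-space over to continuity along a coordinate
    axis. *)
Lemma cvg_axis i x :
  (fun h : R => x + h *: delta_mx 0 i) @ within (axis_dom i x) 0^' -->
  within (@halfspace R n) (nbhs x).
Proof.
move=> P nP; change (nbhs x (fun y => halfspace y -> P y)) in nP.
change (nbhs (0 : R) (fun h => h != 0 -> axis_dom i x h -> P (x + h *: delta_mx 0 i))).
have c : (fun h : R => x + h *: delta_mx 0 i) @ (0 : R) --> x.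
  have c : (fun h : R => x + h *: delta_mx 0 i) @ (0:R) --> x + 0 *: delta_mx 0 i.
    by apply: cvgD; [exact: cvg_cst | apply: cvgZl; exact: cvg_id].
  by rewrite scale0r addr0 in c.
have nQ : nbhs (0 : R) (fun h => halfspace (x + h *: delta_mx 0 i) -> P (x + h *: delta_mx 0 i)).
  by exact: (c _ nP).
by apply: (filterS _ nQ) => h Ph _; apply: Ph.
Qed.

Definition cts_at f x : Prop := f @ within (@halfspace R n) (nbhs x) --> f x.

Lemma cts_at_axis i f x : cts_at f x ->
  (fun h => f (x + h *: delta_mx 0 i)) @ within (axis_dom i x) 0^' -->
  f (x + 0 *: delta_mx 0 i).
Proof.
move=> cf; have c := cvg_comp _ _ (@cvg_axis i x) cf.
by rewrite scale0r addr0; apply: cvg_trans c; apply: near_eq_cvg; apply: nearW.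
Qed.

Lemma is_pderiv_eq i f g x l : halfspace x ->
  (\forall y \near within (@halfspace R n) (nbhs x), f y = g y) -> f x = g x ->
  is_pderiv i f x l -> is_pderiv i g x l.
Proof.
move=> hx fg fgx; apply: relderiv_eq; last by rewrite scale0r addr0.
exact: (@cvg_axis i x _ fg).
Qed.

Lemma is_pderiv_cst i (c : R) x : is_pderiv i (fun=> c) x 0.
Proof. exact: relderiv_cst. Qed.

Lemma is_pderivD i f g x l m : is_pderiv i f x l -> is_pderiv i g x m ->
  is_pderiv i (fun y => f y + g y) x (l + m).
Proof. exact: relderivD. Qed.

Lemma is_pderivM i f g x l m : is_pderiv i f x l -> is_pderiv i g x m ->
  is_pderiv i (fun y => f y * g y) x (l * g x + f x * m).
Proof. by move=> df dg; have := relderivM df dg; rewrite scale0r addr0. Qed.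

Lemma is_pderivM0 i f g x l : f x = 0 -> is_pderiv i f x l -> cts_at g x ->
  is_pderiv i (fun y => f y * g y) x (l * g x).
Proof.
move=> fx df cg.
have := @relderivM0 R _ _ _ _ _ _ df (@cts_at_axis i _ _ cg).
by rewrite scale0r addr0; apply.
Qed.

Lemma is_pderiv_sum i (I : Type) (r : seq I) (P : pred I) (F : I -> 'rV[R]_n -> R) (l : I -> R) x :
  (forall j, P j -> is_pderiv i (F j) x (l j)) ->
  is_pderiv i (fun y => \sum_(j <- r | P j) F j y) x (\sum_(j <- r | P j) l j).
Proof.
move=> dF; elim: r => [|j r IH].
  by under eq_fun do rewrite big_nil; rewrite big_nil; exact: is_pderiv_cst.
under eq_fun do rewrite big_cons; rewrite big_cons; case: ifP => // Pj.
exact: (is_pderivD (dF j Pj) IH).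
Qed.

Lemma is_pderivV i f x l : f x != 0 -> is_pderiv i f x l ->
  is_pderiv i (fun y => (f y)^-1) x (- l * (f x)^-1 * (f x)^-1).
Proof.
by move=> nz df; have := @relderivV R _ _ _ _ _ df; rewrite scale0r addr0; apply.
Qed.

Lemma is_pderiv_sqrt i f x l : 0 < f x -> is_pderiv i f x l ->
  is_pderiv i (fun y => Num.sqrt (f y)) x (l / (Num.sqrt (f x) *+ 2)).
Proof.
by move=> pos df; have := @relderiv_sqrt R _ _ _ _ _ df; rewrite scale0r addr0; apply.
Qed.

Lemma is_pderiv_coord i j x : is_pderiv i (fun y => y 0 j) x (i == j)%:R.
Proof.
rewrite /is_pderiv.
have -> : (fun h : R => (x + h *: delta_mx 0 i) 0 j) = (fun h => x 0 j + h * (i == j)%:R).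
  by apply/funext => h; rewrite !mxE eqxx /= eq_sym.
have := relderivD (relderiv_cst (axis_dom i x) 0 (x 0 j))
  (relderivM (@relderiv_id _ (axis_dom i x) 0) (relderiv_cst (axis_dom i x) 0 (i == j)%:R)).
by rewrite add0r mul1r mul0r addr0.
Qed.

Lemma cts_at_cst (c : R) x : cts_at (fun=> c) x.
Proof. exact: cvg_cst. Qed.

Lemma cts_atD f g x : cts_at f x -> cts_at g x -> cts_at (fun y => f y + g y) x.
Proof. exact: cvgD. Qed.

Lemma cts_atM f g x : cts_at f x -> cts_at g x -> cts_at (fun y => f y * g y) x.
Proof. exact: cvgM. Qed.

Lemma cts_atV f x : f x != 0 -> cts_at f x -> cts_at (fun y => (f y)^-1) x.
Proof. by move=> nz; exact: cvgV. Qed.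

Lemma cts_at_sqrt f x : cts_at f x -> cts_at (fun y => Num.sqrt (f y)) x.
Proof. by move=> cf; apply: continuous_cvg => //; exact: sqrt_continuous. Qed.

Lemma cts_at_eq f g x : (\forall y \near within (@halfspace R n) (nbhs x), f y = g y) ->
  f x = g x -> cts_at f x -> cts_at g x.
Proof. by rewrite /cts_at => fg <-; apply: cvg_trans; apply: near_eq_cvg. Qed.

End PartialDerivatives.

Section Regularity.
Local Open Scope classical_set_scope.
Variables (R : realType) (n : nat) (O : set 'rV[R]_n).
Hypothesis openO : exists2 W : set 'rV[R]_n, open W & O = W `&` @halfspace R n.
Implicit Types (f g : 'rV[R]_n -> R) (x : 'rV[R]_n) (i : 'I_n).

Lemma sub_halfspace x : O x -> halfspace x.
Proof. by case: openO => W _ -> []. Qed.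

Lemma near_O x : O x -> \forall y \near within (@halfspace R n) (nbhs x), O y.
Proof.
case: openO => W oW -> [Wx _].
have nW : nbhs x W by exact: open_nbhs_nbhs.
by apply: (filterS _ nW) => y Wy hy.
Qed.

Definition C0 f : Prop := forall x, O x -> cts_at f x.

(** Only first derivatives of the coefficients of the star operator enter the
    principal part of the Laplacian. *)
Definition C1 f : Prop := C0 f /\ exists2 df : 'I_n -> 'rV[R]_n -> R,
  forall i, C0 (df i) & forall i x, O x -> is_pderiv i f x (df i x).

(** At points of O the functions [df] of the definition are the partial derivatives. *)
Lemma C1_pderiv f : C1 f ->
  (forall i, C0 (pderiv i f)) /\ (forall i x, O x -> is_pderiv i f x (pderiv i f x)).
Proof.
case=> _ [df cdf ddf]; have e i x : O x -> df i x = pderiv i f x.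
  by move=> Ox; rewrite (is_pderiv_pderiv (sub_halfspace Ox) (ddf i x Ox)).
split=> i x Ox; last by rewrite -e //; exact: ddf.
apply: cts_at_eq (cdf i x Ox); last exact: e.
by near=> y; apply: e; near: y; exact: near_O.
Unshelve. all: by end_near. Qed.

Lemma smooth_C1 f : smooth_on O f -> C1 f.
Proof.
move=> sf; split; first by move=> x Ox; have [] := sf [::] x Ox.
exists (fun i => pderiv i f) => i x Ox; first by have [] := sf [:: i] x Ox.
have [/(_ i) c _] := sf [::] x Ox; apply/is_pderivE.
exact: c.
Qed.

Lemma C0_eq f g : (forall x, O x -> f x = g x) -> C0 f -> C0 g.
Proof.
move=> fg cf x Ox; apply: cts_at_eq (cf x Ox); last exact: fg.
by near=> y; apply: fg; near: y; exact: near_O.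
Unshelve. all: by end_near. Qed.

Lemma is_pderiv_eqO i f g x l : O x -> (forall y, O y -> f y = g y) ->
  is_pderiv i f x l -> is_pderiv i g x l.
Proof.
move=> Ox fg; apply: is_pderiv_eq; [exact: sub_halfspace| |exact: fg].
by near=> y; apply: fg; near: y; exact: near_O.
Unshelve. all: by end_near. Qed.

Lemma C1_eq f g : (forall x, O x -> f x = g x) -> C1 f -> C1 g.
Proof.
move=> fg [cf [df cdf ddf]]; split; first exact: C0_eq cf.
by exists df => // i x Ox; apply: is_pderiv_eqO (ddf i x Ox).
Qed.

Lemma C0_cst (c : R) : C0 (fun=> c). Proof. by move=> x _; exact: cts_at_cst. Qed.

Lemma C0D f g : C0 f -> C0 g -> C0 (fun y => f y + g y).
Proof. by move=> cf cg x Ox; apply: cts_atD; [exact: cf | exact: cg]. Qed.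

Lemma C0M f g : C0 f -> C0 g -> C0 (fun y => f y * g y).
Proof. by move=> cf cg x Ox; apply: cts_atM; [exact: cf | exact: cg]. Qed.

Lemma C0V f : (forall x, O x -> f x != 0) -> C0 f -> C0 (fun y => (f y)^-1).
Proof. by move=> nz cf x Ox; apply: cts_atV; [exact: nz | exact: cf]. Qed.

Lemma C0_sqrt f : C0 f -> C0 (fun y => Num.sqrt (f y)).
Proof. by move=> cf x Ox; apply: cts_at_sqrt; exact: cf. Qed.

Lemma C1_cst (c : R) : C1 (fun=> c).
Proof.
split; first exact: C0_cst.
by exists (fun _ _ => 0) => [i|i x _]; [exact: C0_cst | exact: is_pderiv_cst].
Qed.

Lemma C1D f g : C1 f -> C1 g -> C1 (fun y => f y + g y).
Proof.
move=> [cf [df cdf ddf]] [cg [dg cdg ddg]]; split; first exact: C0D.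
exists (fun i y => df i y + dg i y) => i; first exact: C0D.
by move=> x Ox; apply: is_pderivD; [exact: ddf | exact: ddg].
Qed.

Lemma C1M f g : C1 f -> C1 g -> C1 (fun y => f y * g y).
Proof.
move=> [cf [df cdf ddf]] [cg [dg cdg ddg]]; split; first exact: C0M.
exists (fun i y => df i y * g y + f y * dg i y) => i; first by apply: C0D; exact: C0M.
by move=> x Ox; apply: is_pderivM; [exact: ddf | exact: ddg].
Qed.

Lemma C1V f : (forall x, O x -> f x != 0) -> C1 f -> C1 (fun y => (f y)^-1).
Proof.
move=> nz [cf [df cdf ddf]]; split; first exact: C0V.
exists (fun i y => - 1 * df i y * (f y)^-1 * (f y)^-1) => i.
  by do !apply: C0M => //; try exact: C0V; exact: C0_cst.
by move=> x Ox; rewrite mulN1r; apply: is_pderivV; [exact: nz | exact: ddf].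
Qed.

Lemma C1_sqrt f : (forall x, O x -> 0 < f x) -> C1 f -> C1 (fun y => Num.sqrt (f y)).
Proof.
move=> pos [cf [df cdf ddf]]; split; first exact: C0_sqrt.
exists (fun i y => df i y * (Num.sqrt (f y) * 2)^-1) => i.
  apply: C0M => //; apply: C0V; last by apply: C0M; [exact: C0_sqrt | exact: C0_cst].
  by move=> x Ox; rewrite mulf_neq0 // gt_eqF // sqrtr_gt0 pos.
by move=> x Ox; rewrite mulr_natr; apply: is_pderiv_sqrt; [exact: pos | exact: ddf].
Qed.

(** A continuous function with values 1 and -1 is locally constant.  It is applied
    to the orientation sign of a chart. *)
Lemma C1_sign f : (forall x, O x -> f x = 1 \/ f x = -1) -> C0 f -> C1 f.
Proof.
move=> sg cf; split=> //; exists (fun _ _ => 0) => [i|i x Ox]; first exact: C0_cst.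
apply: is_pderiv_eq (is_pderiv_cst i (f x) x) => //; first exact: sub_halfspace.
near=> y; have Oy : O y by near: y; exact: near_O.
have lt1 : `|f x - f y| < 1.
  near: y; have := cf x Ox; rewrite /cts_at => /cvgrPdist_lt /(_ 1 ltr01); exact.
case: (sg x Ox) lt1 => ->; case: (sg y Oy) => -> //.
- by rewrite opprK ger0_norm // -[X in _ < X]add0r ltrD2r ltNge ler01.
- by rewrite -opprD normrN ger0_norm // -[X in _ < X]add0r ltrD2r ltNge ler01.
Unshelve. all: by end_near. Qed.

End Regularity.

(** Wedge products, contractions, determinants and exterior powers are polynomial
    in their entries, so they stay in any class of functions that contains the
    constants and is closed under sums and products.  The classes of interest
    are [C0] and [C1]. *)
Section PolynomialClosure.
Variables (R : realType) (T : Type) (n : nat) (P : (T -> R) -> Prop).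
Hypothesis Pcst : forall c : R, P (fun=> c).
Hypothesis PD : forall f g, P f -> P g -> P (fun y => f y + g y).
Hypothesis PM : forall f g, P f -> P g -> P (fun y => f y * g y).
Implicit Types (w e : T -> ext R n).

Lemma closed_sum (I : Type) (r : seq I) (p : pred I) (F : I -> T -> R) :
  (forall j, p j -> P (F j)) -> P (fun y => \sum_(j <- r | p j) F j y).
Proof.
move=> PF; elim: r => [|j r IH]; first by under eq_fun do rewrite big_nil; exact: Pcst.
under eq_fun do rewrite big_cons; have [pj|_ //] := boolP (p j).
by apply: PD => //; exact: PF.
Qed.

Lemma closed_prod (I : Type) (r : seq I) (p : pred I) (F : I -> T -> R) :
  (forall j, p j -> P (F j)) -> P (fun y => \prod_(j <- r | p j) F j y).
Proof.
move=> PF; elim: r => [|j r IH]; first by under eq_fun do rewrite big_nil; exact: Pcst.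
under eq_fun do rewrite big_cons; have [pj|_ //] := boolP (p j).
by apply: PM => //; exact: PF.
Qed.

Lemma closedN f : P f -> P (fun y => - f y).
Proof. by move=> Pf; under eq_fun do rewrite -mulN1r; apply: PM. Qed.

Lemma closed_det m (G : T -> 'M[R]_m) :
  (forall a b, P (fun y => G y a b)) -> P (fun y => \det (G y)).
Proof.
move=> PG; apply: closed_sum => s _; apply: PM; first exact: Pcst.
by apply: closed_prod => a _; exact: PG.
Qed.

Lemma closed_adj m (G : T -> 'M[R]_m) :
  (forall a b, P (fun y => G y a b)) -> forall a b, P (fun y => (\adj (G y)) a b).
Proof.
move=> PG a b; under eq_fun do rewrite mxE /cofactor; apply: PM; first exact: Pcst.
apply: closed_det => c d; under eq_fun do rewrite !mxE; exact: PG.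
Qed.

Lemma closed_mulmx m p q (A : T -> 'M[R]_(m, p)) (B : T -> 'M[R]_(p, q)) :
  (forall a b, P (fun y => A y a b)) -> (forall a b, P (fun y => B y a b)) ->
  forall a b, P (fun y => (A y *m B y) a b).
Proof.
move=> PA PB a b; under eq_fun do rewrite mxE; apply: closed_sum => j _.
by apply: PM; [exact: PA | exact: PB].
Qed.

Definition closed_ext w : Prop := forall B, P (fun y => w y B).

Lemma closed_extD w e : closed_ext w -> closed_ext e -> closed_ext (fun y => w y + e y).
Proof. by move=> Pw Pe B; under eq_fun do rewrite ffunE /=; exact: PD. Qed.

Lemma closed_extZ (a : T -> R) w : P a -> closed_ext w -> closed_ext (fun y => a y *: w y).
Proof. by move=> Pa Pw B; under eq_fun do rewrite extZE; exact: PM. Qed.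

Lemma closed_extN w : closed_ext w -> closed_ext (fun y => - w y).
Proof. by move=> Pw B; under eq_fun do rewrite ffunE /=; exact: closedN. Qed.

Lemma closed_ext_cst (e : ext R n) : closed_ext (fun=> e).
Proof. by move=> B; exact: Pcst. Qed.

Lemma closed_ext_sum (I : Type) (r : seq I) (p : pred I) (F : I -> T -> ext R n) :
  (forall j, p j -> closed_ext (F j)) -> closed_ext (fun y => \sum_(j <- r | p j) F j y).
Proof.
move=> PF B; under eq_fun do rewrite ext_sumE; apply: closed_sum => j pj; exact: PF.
Qed.

Lemma closed_wedge w e : closed_ext w -> closed_ext e -> closed_ext (fun y => wedge (w y) (e y)).
Proof.
move=> Pw Pe; apply: closed_ext_sum => A _; apply: closed_ext_sum => B _.
apply: closed_extZ; last exact: closed_ext_cst.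
by apply: PM => //; apply: PM => //; exact: Pcst.
Qed.

Lemma closed_covec (xi : T -> 'rV[R]_n) :
  (forall j, P (fun y => xi y 0 j)) -> closed_ext (fun y => covec (xi y)).
Proof.
move=> Px; apply: closed_ext_sum => j _; apply: closed_extZ => //; exact: closed_ext_cst.
Qed.

Lemma closed_iprod (v : T -> 'rV[R]_n) w :
  (forall j, P (fun y => v y 0 j)) -> closed_ext w -> closed_ext (fun y => iprod (v y) (w y)).
Proof.
move=> Pv Pw; apply: closed_ext_sum => A _; apply: closed_ext_sum => j _.
apply: closed_extZ; last exact: closed_ext_cst.
by apply: PM => //; apply: PM => //; exact: Pcst.
Qed.

Lemma closed_ext_pow (G : T -> 'M[R]_n) w :
  (forall a b, P (fun y => G y a b)) -> closed_ext w ->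
  closed_ext (fun y => ext_pow (G y) (w y)).
Proof.
move=> PG Pw; apply: closed_ext_sum => C _; apply: closed_extZ => //.
elim: (enum C) => [|c s IH] B.
  by under eq_fun do rewrite /rows_wedge big_nil; exact: closed_ext_cst.
under eq_fun do rewrite rows_wedge_cons; apply: closed_wedge => //; apply: closed_covec => j.
by under eq_fun do rewrite mxE.
Qed.

Lemma closed_sqnorm (G : T -> 'M[R]_n) (v : T -> 'rV[R]_n) :
  (forall a b, P (fun y => G y a b)) -> (forall j, P (fun y => v y 0 j)) ->
  P (fun y => sqnorm (G y) (v y)).
Proof.
move=> PG Pv; apply: closed_mulmx => a b; last first.
  by rewrite (ord1 b); under eq_fun do rewrite mxE; exact: Pv.
by rewrite (ord1 a); apply: closed_mulmx => // c d; rewrite (ord1 c).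
Qed.

Lemma closed_flat (G : T -> 'M[R]_n) (v : T -> 'rV[R]_n) :
  (forall a b, P (fun y => G y a b)) -> (forall j, P (fun y => v y 0 j)) ->
  forall j, P (fun y => flat (G y) (v y) 0 j).
Proof. by move=> PG Pv j; apply: closed_mulmx => // c d; rewrite (ord1 c). Qed.

Lemma closed_Tmap (G : T -> 'M[R]_n) (v : T -> 'rV[R]_n) w :
  (forall a b, P (fun y => G y a b)) -> (forall j, P (fun y => v y 0 j)) ->
  closed_ext w -> closed_ext (fun y => Tmap (G y) (v y) (w y)).
Proof.
move=> PG Pv Pw; apply: closed_extD => //; apply: closed_wedge; last exact: closed_iprod.
by apply: closed_covec; exact: closed_flat.
Qed.

End PolynomialClosure.

(** * Principal parts of the codifferential and of the Laplacian *)

Section ChartOperators.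
Local Open Scope classical_set_scope.
Variables (R : realType) (n : nat) (O : set 'rV[R]_n).
Variables (s : 'rV[R]_n -> R) (G : 'rV[R]_n -> 'M[R]_n) (v : 'rV[R]_n -> 'rV[R]_n).
Hypothesis openO : exists2 W : set 'rV[R]_n, open W & O = W `&` @halfspace R n.
Hypothesis s_sign : forall x, O x -> s x = 1 \/ s x = -1.
Hypothesis s_cts : C0 O s.
Hypothesis G_C1 : forall a b, C1 O (fun x => G x a b).
Hypothesis G_sym : forall x, O x -> (G x)^T = G x.
Hypothesis G_pos : forall x, O x -> posdef (G x).
Hypothesis v_C1 : forall a, C1 O (fun x => v x 0 a).
Implicit Types (w : dform R n) (e : ext R n) (x y : 'rV[R]_n).

Lemma det_G_C1 : C1 O (fun x => \det (G x)).
Proof. by apply: closed_det => //; [exact: C1_cst | exact: C1D | exact: C1M]. Qed.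

Lemma invmx_G_C1 a b : C1 O (fun x => invmx (G x) a b).
Proof.
have nz x : O x -> \det (G x) != 0 by move=> Ox; rewrite gt_eqF // posdef_det //; exact: G_pos.
apply: (@C1_eq _ _ _ openO (fun x => (\det (G x))^-1 * (\adj (G x)) a b)).
  by move=> x Ox; rewrite /invmx posdef_unit ?mxE //; exact: G_pos.
apply: C1M; first by apply: C1V => //; exact: det_G_C1.
by apply: closed_adj => //; [exact: C1_cst | exact: C1D | exact: C1M].
Qed.

Lemma cometric_C1 a b : C1 O (fun x => cometric (G x) (v x) a b).
Proof.
under eq_fun do rewrite mxE; apply: C1D; first exact: invmx_G_C1.
under eq_fun do rewrite mxE big_ord1 !mxE; exact: C1M.
Qed.

Lemma vol_C1 : C1 O (fun x => vol (s x) (G x)).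
Proof.
apply: C1M; first exact: C1_sign.
by apply: C1_sqrt; [move=> x Ox; apply: posdef_det; exact: G_pos | exact: det_G_C1].
Qed.

Lemma star_v_C1 e : closed_ext (C1 O) (fun x => star_v (s x) (G x) (v x) e).
Proof.
move=> B; under eq_fun do rewrite /star_v hodgeE.
apply: C1M; last exact: vol_C1.
apply: C1M; first exact: C1_cst.
apply: (closed_ext_pow (@C1_cst _ _ O) (@C1D _ _ O) (@C1M _ _ O)); first exact: invmx_G_C1.
move=> A; under eq_fun do rewrite ffunE; apply: C1M; first exact: C1_cst.
apply: (closed_Tmap (@C1_cst _ _ O) (@C1D _ _ O) (@C1M _ _ O)) => // C; exact: C1_cst.
Qed.

Lemma C1_C0 f : C1 O f -> C0 O f. Proof. by case. Qed.

Lemma star_v_inv_C0 w : closed_ext (C0 O) w ->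
  closed_ext (C0 O) (fun x => star_v_inv (s x) (G x) (v x) (w x)).
Proof.
have cst := @C0_cst _ _ O; have add := @C0D _ _ O; have mul := @C0M _ _ O.
have cG a b := C1_C0 (G_C1 a b); have cv a := C1_C0 (v_C1 a).
move=> cw; rewrite /star_v_inv /Tinv.
set u := fun x => hodge_inv (s x) (G x) (w x).
have cu : closed_ext (C0 O) u.
  apply: closed_ext_pow => // A; under eq_fun do rewrite ffunE.
  apply: C0M; first by apply: C0M => //; exact: cw.
  by apply: C0V; [move=> x Ox; apply: vol_neq0; auto | exact: C1_C0 vol_C1].
apply: closed_extD => //; apply: closed_extN => //; apply: closed_extZ => //.
  apply: C0V; first by move=> x Ox; apply: sqnorm1_neq0; exact: G_pos.
  exact: (add _ _ (cst 1) (closed_sqnorm cst add mul cG cv)).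
apply: closed_wedge => //; last exact: closed_iprod.
by apply: closed_covec => //; exact: closed_flat.
Qed.

Lemma ext_dE w (dw : 'I_n -> ext R n) x : O x ->
  (forall i A, is_pderiv i (fun y => w y A) x (dw i A)) ->
  ext_d w x = \sum_i wedge (dx R [set i]%SET) (dw i).
Proof.
move=> Ox hw; apply: eq_bigr => i _; congr wedge; apply/ffunP => A.
by rewrite ffunE; apply: is_pderiv_pderiv => //; exact: (sub_halfspace openO).
Qed.

(** The product rule.  The derivatives of q come with the principal symbol of
    delta_v, and the remaining term is q times delta_v of a constant form. *)
Lemma codiff_v_leibniz (J : Type) (r : seq J) (q : J -> 'rV[R]_n -> R)
    (dq : J -> 'I_n -> R) (e : J -> ext R n) w y : O y ->
  (forall z, O z -> w z = \sum_(j <- r) q j z *: e j) ->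
  (forall j i, is_pderiv i (q j) y (dq j i)) ->
  codiff_v s G v w y =
  \sum_(j <- r) (q j y *: codiff_v s G v (fun=> e j) y -
    \sum_i dq j i *: iprod (row i (cometric (G y) (v y))) (e j)).
Proof.
move=> Oy hw hq; have pG := G_pos Oy; have sg := s_sign Oy; have sG := G_sym Oy.
rewrite codiff_vE //; set H := fun z => star_v (s z) (G z) (v z).
pose dH j i : ext R n := [ffun A => pderiv i (fun z => H z (e j) A) y].
have -> : ext_d (fun z => H z (w z)) y = \sum_i wedge (dx R [set i]%SET)
    (\sum_(j <- r) (dq j i *: H y (e j) + q j y *: dH j i)).
  apply: ext_dE => // i A.
  apply: (@is_pderiv_eqO _ _ _ openO i (fun z => \sum_(j <- r) q j z * H z (e j) A)) => //.
    move=> z Oz; rewrite (hw z Oz) /H (linear_sum (star_v _ _ _)) ext_sumE.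
    by apply: eq_bigr => j _; rewrite linearZ /= extZE.
  rewrite ext_sumE; apply: (@is_pderiv_sum _ _ i J r xpredT (fun j z => q j z * H z (e j) A)
    (fun j => (dq j i *: H y (e j) + q j y *: dH j i) A)) => j _.
  have dHE : dH j i A = pderiv i (fun z => H z (e j) A) y by rewrite ffunE.
  rewrite extDE !extZE dHE.
  have [_ dHA] := C1_pderiv openO (star_v_C1 (e j) A).
  exact: (is_pderivM (hq j i) (dHA i y Oy)).
under eq_bigr => i _ do rewrite wedge_sumr.
rewrite exchange_big (linear_sum (star_v_inv (s y) (G y) (v y))); apply: eq_bigr => j _ /=.
under eq_bigr => i _ do rewrite wedgeDr !wedgeZr.
rewrite big_split /= -scaler_sumr (linearD (star_v_inv (s y) (G y) (v y))) addrC /=.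
congr (_ + _); first by rewrite linearZ codiff_vE.
rewrite (linear_sum (star_v_inv (s y) (G y) (v y))) -sumrN; apply: eq_bigr => i _.
by rewrite linearZ /= star_v_symbol // scalerN.
Qed.

Lemma codiff_v_leibniz1 (q : 'rV[R]_n -> R) (dq : 'I_n -> R) e w y : O y ->
  (forall z, O z -> w z = q z *: e) -> (forall i, is_pderiv i q y (dq i)) ->
  codiff_v s G v w y =
  q y *: codiff_v s G v (fun=> e) y -
  \sum_i dq i *: iprod (row i (cometric (G y) (v y))) e.
Proof.
move=> Oy hw hq.
rewrite (@codiff_v_leibniz unit [:: tt] (fun=> q) (fun=> dq) (fun=> e)) ?big_seq1 //.
by move=> z Oz; rewrite big_seq1 hw.
Qed.

Lemma codiff_v_vanishing (q1 q2 : 'rV[R]_n -> R) (dq1 dq2 : 'I_n -> R) e1 e2 w y : O y ->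
  (forall z, O z -> w z = q1 z *: e1 + q2 z *: e2) -> q1 y = 0 -> q2 y = 0 ->
  (forall i, is_pderiv i q1 y (dq1 i)) -> (forall i, is_pderiv i q2 y (dq2 i)) ->
  codiff_v s G v w y =
  - \sum_i dq1 i *: iprod (row i (cometric (G y) (v y))) e1 -
  \sum_i dq2 i *: iprod (row i (cometric (G y) (v y))) e2.
Proof.
move=> Oy hw z1 z2 h1 h2.
rewrite (@codiff_v_leibniz bool [:: true; false] (fun t => if t then q1 else q2)
  (fun t => if t then dq1 else dq2) (fun t => if t then e1 else e2)) //; last by case.
  rewrite big_cons big_seq1 z1 z2.
  by move: (codiff_v _ _ _ _ y) (codiff_v _ _ _ _ y) => c1 c2; rewrite !scale0r !sub0r.
by move=> z Oz; rewrite big_cons big_seq1 hw.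
Qed.

Lemma codiff_v_cst_C0 e : closed_ext (C0 O) (codiff_v s G v (fun=> e)).
Proof.
have cK : closed_ext (C0 O) (fun y => star_v_inv (s y) (G y) (v y)
    (ext_d (fun z => star_v (s z) (G z) (v z) e) y)).
  apply: star_v_inv_C0; apply: closed_ext_sum; [exact: C0_cst|exact: C0D|move=> i _].
  apply: closed_wedge; [exact: C0_cst|exact: C0D|exact: C0M|move=> A; exact: C0_cst|].
  move=> A; under eq_fun do rewrite ffunE.
  by have [+ _] := C1_pderiv openO (star_v_C1 e A); apply.
move=> B; apply: (C0_eq openO) (cK B) => y Oy; rewrite codiff_vE //; [exact: G_pos|exact: s_sign].
Qed.

Lemma is_pderiv_shift i (a : 'I_n) x z :
  is_pderiv i (fun y => y 0 a - x 0 a) z (i == a)%:R.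
Proof.
by have := is_pderivD (@is_pderiv_coord R n i a z) (is_pderiv_cst i (- x 0 a) z); rewrite addr0.
Qed.

Lemma shift_C1 (a : 'I_n) x : C1 O (fun y => y 0 a - x 0 a).
Proof.
split; last first.
  by exists (fun i _ => (i == a)%:R) => i *; [exact: C0_cst | exact: is_pderiv_shift].
move=> z _; rewrite /cts_at; apply: cvgB; last exact: cvg_cst.
by apply: cvg_within_filter; exact: coord_continuous.
Qed.

Lemma sum_delta (a : 'I_n) (f : 'I_n -> ext R n) : \sum_i (i == a)%:R *: f i = f a.
Proof.
rewrite (bigD1 a) //= eqxx scale1r big1 ?addr0 // => i /negbTE ->.
by rewrite scale0r.
Qed.

Lemma top_coef_codiff_v x (I : 1.-tuple 'I_n) e : O x ->
  top_coef (codiff_v s G v) x I e =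
  - iprod (row (tnth I ord0) (cometric (G x) (v x))) e.
Proof.
move=> Ox; rewrite /top_coef invr1 scale1r.
case: I => [[|a []] //= pI]; rewrite (tnth_nth a) /=.
rewrite (@codiff_v_leibniz1 (fun y => y 0 a - x 0 a) (fun i => (i == a)%:R) e) //.
- rewrite subrr sum_delta; move: (codiff_v _ _ _ _ x) => c.
  by rewrite scale0r sub0r.
- by move=> z _; rewrite big_seq1.
- by move=> i; exact: is_pderiv_shift.
Qed.

(** At x, where the scalar factors vanish, the derivatives of w only see the
    values of alpha and beta. *)
Lemma ext_d_vanishing x (a b : 'I_n) (alpha beta w : dform R n) : O x ->
  (forall z, O z -> w z = (z 0 b - x 0 b) *: alpha z + (z 0 a - x 0 a) *: beta z) ->
  (forall A, cts_at (fun z => alpha z A) x) -> (forall A, cts_at (fun z => beta z A) x) ->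
  ext_d w x = wedge (dx R [set b]%SET) (alpha x) + wedge (dx R [set a]%SET) (beta x).
Proof.
move=> Ox hw ca cb.
rewrite (@ext_dE _ (fun i => (i == b)%:R *: alpha x + (i == a)%:R *: beta x)) //; last first.
  move=> i A; apply: (@is_pderiv_eqO _ _ _ openO i (fun z =>
    (z 0 b - x 0 b) * alpha z A + (z 0 a - x 0 a) * beta z A)) => //.
    by move=> z Oz; rewrite hw // extDE !extZE.
  rewrite extDE !extZE; apply: is_pderivD; apply: is_pderivM0 => //; rewrite ?subrr //;
    exact: is_pderiv_shift.
under eq_bigr => i _ do rewrite wedgeDr !wedgeZr.
by rewrite big_split /= !sum_delta.
Qed.

(** At x only those terms survive in which each of the two factors of the monomial
    is differentiated once.  They form two anticommutators of wedging and
    contraction, equal to h a b and h b a. *)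
Lemma top_coef_laplace_v x (I : 2.-tuple 'I_n) e : O x ->
  top_coef (laplace_v s G v) x I e =
  - cometric (G x) (v x) (tnth I ord0) (tnth I (lift ord0 ord0)) *: e.
Proof.
move=> Ox; rewrite /top_coef.
case: I => [[|a [|b []]] //= pI]; rewrite !(tnth_nth a) /=.
set w := fun y : 'rV[R]_n => _; set h := cometric (G x) (v x).
have wE z : w z = (z 0 a - x 0 a) * (z 0 b - x 0 b) *: e.
  by rewrite /w !big_cons big_nil mulr1.
pose hz z := cometric (G z) (v z).
have dw i z A : is_pderiv i (fun y => w y A) z
    (((i == a)%:R * (z 0 b - x 0 b) + (z 0 a - x 0 a) * (i == b)%:R) * e A).
  under eq_fun do rewrite wE extZE.
  have := is_pderivM (is_pderivM (@is_pderiv_shift i a x z) (@is_pderiv_shift i b x z))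
    (is_pderiv_cst i (e A) z).
  by rewrite mulr0 addr0.
(* d w is again a combination of forms with coefficients vanishing at x *)
have d2 : codiff_v s G v (ext_d w) x =
    - iprod (row b h) (wedge (dx R [set a]%SET) e) - iprod (row a h) (wedge (dx R [set b]%SET) e).
  rewrite (@codiff_v_vanishing (fun y => y 0 b - x 0 b) (fun y => y 0 a - x 0 a)
     (fun i => (i == b)%:R) (fun i => (i == a)%:R)
     (wedge (dx R [set a]%SET) e) (wedge (dx R [set b]%SET) e)) ?subrr //.
  - by rewrite !sum_delta.
  - move=> z Oz.
    rewrite (@ext_dE _ (fun i => ((i == a)%:R * (z 0 b - x 0 b) +
       (z 0 a - x 0 a) * (i == b)%:R) *: e)) //; last first.
      by move=> i A; rewrite extZE; exact: dw.
    transitivity (\sum_i ((i == a)%:R *: ((z 0 b - x 0 b) *: wedge (dx R [set i]%SET) e) +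
      (i == b)%:R *: ((z 0 a - x 0 a) *: wedge (dx R [set i]%SET) e))).
      apply: eq_bigr => i _; rewrite wedgeZr scalerDl !scalerA.
      by rewrite [(i == b)%:R * _]mulrC.
    by rewrite big_split /= !sum_delta.
  - by move=> i; exact: is_pderiv_shift.
  - by move=> i; exact: is_pderiv_shift.
(* every term of delta_v w keeps a factor y - x, by which it is grouped *)
have d1 : ext_d (codiff_v s G v w) x =
    - wedge (dx R [set b]%SET) (iprod (row a h) e) - wedge (dx R [set a]%SET) (iprod (row b h) e).
  rewrite (@ext_d_vanishing x a b
    (fun z => - iprod (row a (hz z)) e + (z 0 a - x 0 a) *: codiff_v s G v (fun=> e) z)
    (fun z => - iprod (row b (hz z)) e)) //.
  - rewrite subrr scale0r addr0 (linearN (wedge _)) (linearN (wedge _)) //.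
  - move=> z Oz; rewrite (@codiff_v_leibniz1
      (fun y => (y 0 a - x 0 a) * (y 0 b - x 0 b))
      (fun i => (i == a)%:R * (z 0 b - x 0 b) + (z 0 a - x 0 a) * (i == b)%:R) e) //.
    + move: (codiff_v _ _ _ _ z) => c.
      rewrite scalerDr scalerA [_ * (z 0 a - _)]mulrC addrAC [RHS]addrC.
      congr (_ + _); rewrite scalerN [X in _ = _ + X]scalerN -opprD; congr (- _).
      transitivity (\sum_i ((i == a)%:R *: ((z 0 b - x 0 b) *: iprod (row i (hz z)) e) +
        (i == b)%:R *: ((z 0 a - x 0 a) *: iprod (row i (hz z)) e))).
        apply: eq_bigr => i _; rewrite scalerDl !scalerA.
        by rewrite [(i == b)%:R * _]mulrC.
      by rewrite big_split /= !sum_delta.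
    + by move=> i; apply: is_pderivM; exact: is_pderiv_shift.
  - move=> A; have : C0 O (fun z => (- iprod (row a (hz z)) e +
        (z 0 a - x 0 a) *: codiff_v s G v (fun=> e) z) A).
      have cst := @C0_cst _ _ O; have add := @C0D _ _ O; have mul := @C0M _ _ O.
      apply: closed_extD => //; last first.
        by apply: closed_extZ => //; [exact: C1_C0 (shift_C1 a x) | exact: codiff_v_cst_C0].
      apply: closed_extN => //; apply: closed_iprod => //.
      by move=> j; under eq_fun do rewrite mxE; exact: C1_C0 (cometric_C1 a j).
    exact.
  - move=> A; have : C0 O (fun z => (- iprod (row b (hz z)) e) A).
      have cst := @C0_cst _ _ O; have add := @C0D _ _ O; have mul := @C0M _ _ O.
      apply: closed_extN => //; apply: closed_iprod => //.
      by move=> j; under eq_fun do rewrite mxE; exact: C1_C0 (cometric_C1 b j).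
    exact.
rewrite /laplace_v d1 d2.
have car i j : wedge (dx R [set i]%SET) (iprod (row j h) e) +
    iprod (row j h) (wedge (dx R [set i]%SET) e) = h j i *: e.
  by rewrite dx_covec anticomm_covec_iprod -rowE !mxE.
have hab : h b a = h a b by rewrite /h -[in LHS](cometric_sym (v x) (G_sym Ox)) mxE.
rewrite [X in _ *: (_ + X)]addrC -!opprD addrACA !car hab -scalerDl.
rewrite scalerN -scaleNr scalerA; congr (_ *: _).
by rewrite (_ : 2`! = 2)%N //; field.
Qed.

End ChartOperators.

(** * Bounded solutions of second-order equations on the half-line *)

Section HalfLineEquation.
Local Open Scope classical_set_scope.
Variable R : realType.
Implicit Types (f g : R -> R) (t : R).

Lemma halfline_nbhs t : 0 < t -> nbhs t [set u : R | 0 <= u].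
Proof.
move=> t0; near=> u; rewrite /= ltW //; near: u.
exact: (cvgr_gt t (@cvg_id _ (nbhs t)) _ t0).
Unshelve. all: by end_near. Qed.

Lemma relderiv_linear_comp (D : set R) f df k t :
  is_derive (k * t) 1 f df -> relderiv D (fun u => f (k * u)) t (k * df).
Proof.
move=> hf; apply: is_derive_relderiv.
have hk : is_derive t 1 (fun u : R => k * u) k.
  have := @is_deriveZ R R R id k t 1 1 _; rewrite /GRing.scale /= mulr1; apply.
have := @is_derive1_comp R f (fun u => k * u) t df k hf hk.
by rewrite mulrC.
Qed.

Lemma halfline_deriv0 f : is_deriv_halfline f (fun=> 0) -> forall t, 0 <= t -> f t = f 0.
Proof.
move=> df t t0; apply/eqP; rewrite -subr_eq0.
have [| |c _ ->] := @MVT_segment R f (fun=> 0) 0 t t0; last by rewrite mul0r.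
  move=> x; rewrite in_itv /= => /andP[x0 _]; apply: (@relderiv_is_derive _ [set u | 0 <= u]).
    exact: halfline_nbhs.
  exact: df (ltW x0).
apply/subspace_continuousP => x; rewrite /= in_itv /= => /andP[x0 _].
have c := relderiv_cts (df x x0) => P nP.
change (nbhs x (fun u => u \in `[0, t]%R -> P (f u))).
have nQ : nbhs x (fun u => u != x -> 0 <= u -> P (f u)) by exact: (c _ nP).
apply: (filterS _ nQ) => u Pu; rewrite in_itv /= => /andP[u0 _].
have [->|ux] := eqVneq u x; first exact: nbhs_singleton.
exact: Pu.
Qed.

(** The bound exp(s) >= 1 + s contradicts the hypothesis at t = M / (mu |g|)
    unless g = 0. *)
Lemma exp_unbounded (mu M g : R) : 0 < mu ->
  (forall t, 0 <= t -> `|g| * expR (mu * t) <= M) -> g = 0.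
Proof.
move=> mu0 hM; apply/eqP/negPn/negP => g0.
have gp : 0 < `|g| by rewrite normr_gt0.
have M0 : 0 <= M.
  by apply: le_trans (hM 0 (lexx 0)); rewrite mulr_ge0 // expR_ge0.
pose t := M / (mu * `|g|).
have t0 : 0 <= t by rewrite divr_ge0 // mulr_ge0 // ltW.
have := le_trans (ler_wpM2l (ltW gp) (expR_ge1Dx (mu * t))) (hM t t0).
rewrite mulrDr mulr1 [X in _ + X](_ : _ = M); last first.
  by rewrite /t; field; rewrite !gt_eqF.
by rewrite leNgt ltrDr gp.
Qed.

(** For k = mu and k = - mu, f' - k f is a multiple of exp(- k t).  Solving for f,
    boundedness forces the multiple of exp(mu t) to vanish. *)
Lemma bounded_decay (mu C : R) f f1 f2 : 0 < mu ->
  is_deriv_halfline f f1 -> is_deriv_halfline f1 f2 ->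
  (forall t, 0 <= t -> f2 t = mu ^+ 2 * f t) ->
  (forall t, 0 <= t -> `|f t| <= C) ->
  (forall t, 0 <= t -> f t = f 0 * expR (- mu * t)) /\ f1 0 = - mu * f 0.
Proof.
move=> mu0 df df1 f2E fC.
have dexp k t : relderiv [set u : R | 0 <= u] (fun u => expR (k * u)) t (k * expR (k * t)).
  by apply: relderiv_linear_comp; exact: is_derive_expR.
have conserved k : k ^+ 2 = mu ^+ 2 ->
    forall t, 0 <= t -> f1 t - k * f t = (f1 0 - k * f 0) * expR (- k * t).
  move=> k2 t t0.
  have d0 : is_deriv_halfline (fun u => (f1 u + - k * f u) * expR (k * u)) (fun=> 0).
    move=> u u0; have := relderivM (relderivD (df1 u u0)
      (relderivM (relderiv_cst _ _ (- k)) (df u u0))) (dexp k u).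
    rewrite [X in relderiv _ _ _ X](_ : _ = 0) //.
    by rewrite (f2E u u0) -k2; ring.
  have := halfline_deriv0 d0 t0; rewrite mulr0 expR0 mulr1 -!mulNr => <-.
  by rewrite -mulrA -expRD -mulrDl addrN mul0r expR0 mulr1.
have cp t (t0 : 0 <= t) := conserved (- mu) (sqrrN mu) t t0.
have cm t (t0 : 0 <= t) := conserved mu erefl t t0.
set g := f1 0 - - mu * f 0 in cp; set h := f1 0 - mu * f 0 in cm.
have fE t : 0 <= t -> mu *+ 2 * f t = g * expR (mu * t) - h * expR (- mu * t).
  by move=> t0; have := cp t t0; rewrite opprK => <-; rewrite -cm //; ring.
have g0 : g = 0.
  apply: (@exp_unbounded mu (mu *+ 2 * C + `|h|)) => // t t0.
  rewrite -[X in _ * X]gtr0_norm ?expR_gt0 // -normrM.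
  have -> : g * expR (mu * t) = mu *+ 2 * f t + h * expR (- mu * t).
    by rewrite fE // subrK.
  apply: le_trans (ler_normD _ _) _; apply: lerD.
    have mu2 : 0 <= mu *+ 2 by rewrite mulrn_wge0 // ltW.
    by rewrite normrM (ger0_norm mu2) ler_wpM2l // fC.
  rewrite normrM -[X in _ <= X]mulr1 ler_wpM2l // gtr0_norm ?expR_gt0 //.
  by rewrite -expR0 ler_expR mulNr oppr_le0 mulr_ge0 // ltW.
have f10 : f1 0 = - mu * f 0 by apply/eqP; rewrite -subr_eq0 -/g g0.
split=> // t t0; apply: (@mulfI _ (mu *+ 2)); first by rewrite mulrn_eq0 /= gt_eqF.
rewrite (fE t t0) g0 /h f10; ring.
Qed.

(** Multiplication by exp(i beta t) turns d/dt + i beta into d/dt; here it is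
    applied to r + i m. *)
Lemma rotate_deriv (beta : R) r m r1 m1 :
  is_deriv_halfline r r1 -> is_deriv_halfline m m1 ->
  is_deriv_halfline (fun t => cos (beta * t) * r t - sin (beta * t) * m t)
    (fun t => cos (beta * t) * (r1 t - beta * m t) - sin (beta * t) * (m1 t + beta * r t)) /\
  is_deriv_halfline (fun t => sin (beta * t) * r t + cos (beta * t) * m t)
    (fun t => sin (beta * t) * (r1 t - beta * m t) + cos (beta * t) * (m1 t + beta * r t)).
Proof.
move=> dr dm.
have dcos t : relderiv [set u : R | 0 <= u] (fun u => cos (beta * u)) t (beta * - sin (beta * t)).
  by apply: relderiv_linear_comp; exact: is_derive_cos.
have dsin t : relderiv [set u : R | 0 <= u] (fun u => sin (beta * u)) t (beta * cos (beta * t)).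
  by apply: relderiv_linear_comp; exact: is_derive_sin.
split=> t t0.
  have := relderivD (relderivM (dcos t) (dr t t0))
    (relderivM (relderiv_cst _ t (-1)) (relderivM (dsin t) (dm t t0))).
  rewrite /relderiv; under eq_fun do rewrite !mulN1r.
  by rewrite [X in _ --> X -> _](_ : _ =
    cos (beta * t) * (r1 t - beta * m t) - sin (beta * t) * (m1 t + beta * r t)) //; ring.
have := relderivD (relderivM (dsin t) (dr t t0)) (relderivM (dcos t) (dm t t0)).
by rewrite [X in relderiv _ _ _ X](_ : _ =
  sin (beta * t) * (r1 t - beta * m t) + cos (beta * t) * (m1 t + beta * r t)) //; ring.
Qed.

Lemma cos_sin_sq (x : R) : cos x * cos x + sin x * sin x = 1.
Proof. by rewrite -!expr2 cos2Dsin2. Qed.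

(** The equation is a y'' + 2 i b y' - c y = 0 for y = r + i m.  The function
    exp(i beta t) y solves z'' = mu^2 z, where real and imaginary parts decouple. *)
Lemma bounded_complex_decay (a b c beta mu C : R) r m r1 m1 r2 m2 :
  0 < mu -> a != 0 -> b = a * beta -> c = a * (mu ^+ 2 + beta ^+ 2) ->
  is_deriv_halfline r r1 -> is_deriv_halfline r1 r2 ->
  is_deriv_halfline m m1 -> is_deriv_halfline m1 m2 ->
  (forall t, 0 <= t -> a * r2 t - b *+ 2 * m1 t - c * r t = 0) ->
  (forall t, 0 <= t -> a * m2 t + b *+ 2 * r1 t - c * m t = 0) ->
  (forall t, 0 <= t -> `|r t| <= C /\ `|m t| <= C) ->
  [/\ forall t, 0 <= t ->
        r t = expR (- mu * t) * (cos (beta * t) * r 0 + sin (beta * t) * m 0),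
      forall t, 0 <= t ->
        m t = expR (- mu * t) * (cos (beta * t) * m 0 - sin (beta * t) * r 0),
      r1 0 = - mu * r 0 + beta * m 0 &
      m1 0 = - mu * m 0 - beta * r 0].
Proof.
move=> mu0 a0 bE cE dr dr1 dm dm1 eqr eqm bd.
have [dzr dzm] := rotate_deriv beta dr dm.
have dp1 : is_deriv_halfline (fun t => r1 t - beta * m t) (fun t => r2 t - beta * m1 t).
  move=> t t0; have := relderivD (dr1 t t0) (relderivM (relderiv_cst _ t (- beta)) (dm t t0)).
  rewrite /relderiv; under eq_fun do rewrite !mulNr.
  by rewrite mul0r add0r mulNr.
have dp2 : is_deriv_halfline (fun t => m1 t + beta * r t) (fun t => m2 t + beta * r1 t).
  move=> t t0; have := relderivD (dm1 t t0) (relderivM (relderiv_cst _ t beta) (dr t t0)).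
  by rewrite mul0r add0r.
have [dzr1 dzm1] := rotate_deriv beta dp1 dp2.
have er t : 0 <= t -> r2 t - beta * m1 t - beta * (m1 t + beta * r t) = mu ^+ 2 * r t.
  move=> t0; apply: (mulfI a0); apply: subr0_eq; rewrite -[RHS](eqr t t0) bE cE.
  by ring.
have em t : 0 <= t -> m2 t + beta * r1 t + beta * (r1 t - beta * m t) = mu ^+ 2 * m t.
  move=> t0; apply: (mulfI a0); apply: subr0_eq; rewrite -[RHS](eqm t t0) bE cE.
  by ring.
have bound x y t : 0 <= t -> `|x| <= 1 -> `|y| <= 1 -> `|x * r t + y * m t| <= C + C.
  move=> t0 hx hy; have [hr hm] := bd t t0; apply: le_trans (ler_normD _ _) _.
  by rewrite !normrM; apply: lerD; rewrite -[X in _ <= X]mul1r; apply: ler_pM.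
have hc t : `|cos (beta * t)| <= 1 by rewrite ler_norml cos_le1 cos_geN1.
have hs t : `|sin (beta * t)| <= 1 by rewrite ler_norml sin_le1 sin_geN1.
have [||zrE zr1] := @bounded_decay mu (C + C) _ _ _ mu0 dzr dzr1.
- by move=> t t0; rewrite er // em //; ring.
- by move=> t t0; rewrite -mulNr; apply: bound; rewrite ?normrN.
have [||zmE zm1] := @bounded_decay mu (C + C) _ _ _ mu0 dzm dzm1.
- by move=> t t0; rewrite er // em //; ring.
- by move=> t t0; apply: bound.
rewrite !mulr0 cos0 sin0 !mul1r !mul0r ?subr0 ?add0r in zrE zr1 zmE zm1.
split.
- move=> t t0; rewrite -[LHS]mul1r -(cos_sin_sq (beta * t)).
  transitivity (cos (beta * t) * (cos (beta * t) * r t - sin (beta * t) * m t) +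
    sin (beta * t) * (sin (beta * t) * r t + cos (beta * t) * m t)); first by ring.
  by rewrite zrE // zmE //; ring.
- move=> t t0; rewrite -[LHS]mul1r -(cos_sin_sq (beta * t)).
  transitivity (cos (beta * t) * (sin (beta * t) * r t + cos (beta * t) * m t) -
    sin (beta * t) * (cos (beta * t) * r t - sin (beta * t) * m t)); first by ring.
  by rewrite zrE // zmE //; ring.
- by rewrite -zr1 subrK.
- by rewrite -zm1 addrK.
Qed.

(** Real and imaginary part of exp((- mu - i beta) t) (r + i m). *)
Definition decay_re (mu beta r m t : R) : R :=
  expR (- mu * t) * (cos (beta * t) * r + sin (beta * t) * m).
Definition decay_im (mu beta r m t : R) : R :=
  expR (- mu * t) * (cos (beta * t) * m - sin (beta * t) * r).

Lemma decay_deriv (mu beta r m : R) :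
  is_deriv_halfline (decay_re mu beta r m)
    (decay_re mu beta (- mu * r + beta * m) (- mu * m - beta * r)) /\
  is_deriv_halfline (decay_im mu beta r m)
    (decay_im mu beta (- mu * r + beta * m) (- mu * m - beta * r)).
Proof.
have dexp t : relderiv [set u : R | 0 <= u] (fun u => expR (- mu * u)) t (- mu * expR (- mu * t)).
  by apply: relderiv_linear_comp; exact: is_derive_expR.
have dcos t : relderiv [set u : R | 0 <= u] (fun u => cos (beta * u)) t (beta * - sin (beta * t)).
  by apply: relderiv_linear_comp; exact: is_derive_cos.
have dsin t : relderiv [set u : R | 0 <= u] (fun u => sin (beta * u)) t (beta * cos (beta * t)).
  by apply: relderiv_linear_comp; exact: is_derive_sin.
have cst (x t : R) := relderiv_cst [set u : R | 0 <= u] t x.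
split=> t t0.
  have := relderivM (dexp t)
    (relderivD (relderivM (dcos t) (cst r t)) (relderivM (dsin t) (cst m t))).
  by rewrite [X in relderiv _ _ _ X](_ : _ =
    decay_re mu beta (- mu * r + beta * m) (- mu * m - beta * r) t) // /decay_re; ring.
have := relderivM (dexp t)
  (relderivD (relderivM (dcos t) (cst m t)) (relderivM (dsin t) (cst (- r) t))).
rewrite /relderiv; under eq_fun do rewrite !mulrN.
by rewrite [X in _ --> X -> _](_ : _ =
  decay_im mu beta (- mu * r + beta * m) (- mu * m - beta * r) t) // /decay_im; ring.
Qed.

Lemma decay_bounded (mu beta r m t : R) : 0 < mu -> 0 <= t ->
  `|decay_re mu beta r m t| <= `|r| + `|m| /\ `|decay_im mu beta r m t| <= `|r| + `|m|.
Proof.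
move=> mu0 t0.
have e1 : `|expR (- mu * t)| <= 1.
  by rewrite gtr0_norm ?expR_gt0 // -expR0 ler_expR mulNr oppr_le0 mulr_ge0 // ltW.
have hc : `|cos (beta * t)| <= 1 by rewrite ler_norml cos_le1 cos_geN1.
have hs : `|sin (beta * t)| <= 1 by rewrite ler_norml sin_le1 sin_geN1.
have comb x y p q : `|x| <= 1 -> `|y| <= 1 -> `|x * p + y * q| <= `|p| + `|q|.
  move=> hx hy; apply: le_trans (ler_normD _ _) _.
  by rewrite !normrM; apply: lerD; rewrite -[X in _ <= X]mul1r; apply: ler_pM.
split; rewrite /decay_re /decay_im normrM -[X in _ <= X]mul1r; apply: ler_pM => //.
  exact: comb.
by rewrite [X in _ <= X]addrC -mulNr; apply: comb; rewrite ?normrN.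
Qed.

End HalfLineEquation.

(** * Restriction of forms to the boundary *)

Section Degrees.
Variables (F : fieldType) (n : nat).
Implicit Types (w e : ext F n) (A B : {set 'I_n}) (k : int).

Lemma homog_eq0 k w A : homog k w -> #|A|%:Z != k -> w A = 0.
Proof. by move=> hw nk; apply/eqP/negPn/negP => /hw e; rewrite e eqxx in nk. Qed.

Lemma homogD k w e : homog k w -> homog k e -> homog k (w + e).
Proof.
move=> hw he A; have [//|nk] := eqVneq #|A|%:Z k.
by rewrite extDE (homog_eq0 hw nk) (homog_eq0 he nk) addr0 eqxx.
Qed.

Lemma homogZ k (a : F) w : homog k w -> homog k (a *: w).
Proof.
move=> hw A; have [//|nk] := eqVneq #|A|%:Z k.
by rewrite extZE (homog_eq0 hw nk) mulr0 eqxx.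
Qed.

Lemma homog_iprod k u w : homog k w -> homog (k - 1) (iprod u w).
Proof.
move=> hw B; have [//|nk] := eqVneq #|B|%:Z (k - 1).
rewrite iprodE big1 ?eqxx // => i iB; rewrite (homog_eq0 hw) ?mulr0 //.
by apply: contra nk => /eqP <-; rewrite cardsU1 iB PoszD addrAC subrr add0r.
Qed.

Lemma homog_wedge_dx k i w : homog (k - 1) w -> homog k (wedge (dx F [set i]) w).
Proof.
move=> hw B; have [//|nk] := eqVneq #|B|%:Z k.
rewrite wedge_dx1E; case: ifP => iB; last by rewrite eqxx.
rewrite (homog_eq0 hw) ?mulr0 ?eqxx //.
by apply: contra nk => /eqP e; rewrite (cardsD1 i) iB PoszD e addrC subrK.
Qed.

End Degrees.

Section BoundaryRestriction.
Variables (F : fieldType) (n : nat) (i0 : 'I_n).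
Implicit Types (w : ext F n) (b : ext F n.-1) (A : {set 'I_n}) (B : {set 'I_n.-1}) (k : int).

Definition tang_part A : {set 'I_n.-1} := [set j | lift i0 j \in A].

Lemma tang_partK A : i0 \notin A -> [set lift i0 j | j in tang_part A] = A.
Proof.
move=> iA; apply/setP => a; apply/imsetP/idP => [[j]|aA]; first by rewrite inE => jA ->.
by case: (unliftP i0 a) aA iA => [j ->|->] aA; rewrite ?aA // => _; exists j; rewrite ?inE.
Qed.

Lemma tang_part_lift B : tang_part [set lift i0 j | j in B] = B.
Proof. by apply/setP => j; rewrite inE mem_imset //; exact: lift_inj. Qed.

Lemma normal_notin_lift B : i0 \notin [set lift i0 j | j in B].
Proof. by apply/imsetP => -[j _ e]; have := neq_lift i0 j; rewrite -e eqxx. Qed.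

(** A right inverse of [restr], with values in the forms without dx^i0 component. *)
Definition tang_ext b : ext F n := [ffun A : {set 'I_n} => if i0 \in A then 0 else b (tang_part A)].

Lemma restrE w B : restr i0 w B = w [set lift i0 j | j in B].
Proof. by rewrite ffunE. Qed.

Lemma tang_extK : cancel tang_ext (@restr F n i0).
Proof.
by move=> b; apply/ffunP => B; rewrite !ffunE (negbTE (normal_notin_lift B)) tang_part_lift.
Qed.

Lemma restrD w1 w2 : restr i0 (w1 + w2) = restr i0 w1 + restr i0 w2.
Proof. by apply/ffunP => B; rewrite !ffunE. Qed.

Lemma restrZ (a : F) w : restr i0 (a *: w) = a *: restr i0 w.
Proof. by apply/ffunP => B; rewrite !ffunE. Qed.

Lemma restr_sum (I : Type) (r : seq I) (P : pred I) (f : I -> ext F n) :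
  restr i0 (\sum_(i <- r | P i) f i) = \sum_(i <- r | P i) restr i0 (f i).
Proof.
apply: (big_morph (restr i0)) => [w1 w2|]; first exact: restrD.
by apply/ffunP => B; rewrite !ffunE.
Qed.

Lemma restr_wedge_normal w : restr i0 (wedge (dx F [set i0]) w) = 0.
Proof.
by apply/ffunP => B; rewrite ffunE wedge_dx1E (negbTE (normal_notin_lift B)) ffunE.
Qed.

Lemma restr_iprod_wedge u w :
  restr i0 (iprod u (wedge (dx F [set i0]) w)) = u 0 i0 *: restr i0 w.
Proof.
have := anticomm_covec_iprod (delta_mx 0 i0) u w; rewrite -dx_covec -rowE !mxE.
move/(canRL (addKr _)) => ->; rewrite restrD restrZ -scaleN1r restrZ restr_wedge_normal.
by rewrite scaler0 add0r.
Qed.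

Lemma homog_restr k w : homog k w -> homog k (restr i0 w).
Proof. by move=> hw B; rewrite ffunE => /hw; rewrite card_imset //; exact: lift_inj. Qed.

Lemma homog_tang_ext k b : homog k b -> homog k (tang_ext b).
Proof.
move=> hb A; rewrite ffunE; case: ifP => iA; first by rewrite eqxx.
by move/hb; rewrite -{2}(tang_partK (negbT iA)) card_imset //; exact: lift_inj.
Qed.

(** The restriction of z is its tangential part.  Of the normal part dx^i0 /\ c,
    contraction with u and restriction leave u_i0 c, which is known once the
    tangential part is. *)
Lemma restr_iprod_inj (u : 'rV[F]_n) z1 z2 : u 0 i0 != 0 ->
  restr i0 z1 = restr i0 z2 -> restr i0 (iprod u z1) = restr i0 (iprod u z2) -> z1 = z2.
Proof.
move=> u0 r12 ri12; apply/eqP; rewrite -subr_eq0; apply/eqP; set z := z1 - z2.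
have rz : restr i0 z = 0 by rewrite restrD -scaleN1r restrZ r12 scaleN1r subrr.
have riz : restr i0 (iprod u z) = 0.
  by rewrite iprodDr -scaleN1r iprodZr restrD restrZ ri12 scaleN1r subrr.
have tang0 w : restr i0 w = 0 -> forall A, i0 \notin A -> w A = 0.
  by move=> rw A iA; have /ffunP/(_ (tang_part A)) := rw; rewrite !ffunE tang_partK.
apply/ffunP => A; rewrite [RHS]ffunE; have [iA|/(tang0 _ rz)//] := boolP (i0 \in A).
have iA' : i0 \notin A :\ i0 by rewrite !inE eqxx.
have := tang0 _ riz _ iA'; rewrite iprodE (bigD1 i0) //= finset.setD1K // big1 ?addr0.
  by move/eqP; rewrite !mulf_eq0 (negbTE u0) signr_eq0 /= => /eqP.
move=> j /andP[jA ji]; rewrite (tang0 _ rz) ?mulr0 // !inE negb_or eq_sym ji /=.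
by rewrite eqxx.
Qed.

Lemma restr_iprod_surj k (u : 'rV[F]_n) b1 b2 : u 0 i0 != 0 -> homog k b1 -> homog (k - 1) b2 ->
  exists z, [/\ homog k z, restr i0 z = b1 & restr i0 (iprod u z) = b2].
Proof.
move=> u0 h1 h2; pose t := tang_ext b1.
have ht : homog k t by exact: homog_tang_ext.
pose c := tang_ext (b2 - restr i0 (iprod u t)).
exists (t + (u 0 i0)^-1 *: wedge (dx F [set i0]) c); split.
- apply: homogD => //; apply: homogZ; apply: homog_wedge_dx; apply: homog_tang_ext.
  by apply: homogD => //; rewrite -scaleN1r; apply: homogZ; apply: homog_restr; exact: homog_iprod.
- by rewrite restrD restrZ restr_wedge_normal scaler0 addr0 tang_extK.
rewrite iprodDr iprodZr restrD restrZ restr_iprod_wedge scalerA mulVf // scale1r tang_extK.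
by rewrite addrC subrK.
Qed.

End BoundaryRestriction.

(** * The frozen problem *)

Section TupleSums.
Variables (V : zmodType) (n : nat).

Lemma sum_tuple0 (F : 0.-tuple 'I_n -> V) : \sum_I F I = F [tuple].
Proof.
rewrite (bigD1 [tuple]) //= big1 ?addr0 // => I.
by rewrite (tuple0 I) => /eqP[].
Qed.

Lemma sum_tuple1 (F : 1.-tuple 'I_n -> V) : \sum_I F I = \sum_a F [tuple a].
Proof.
rewrite (reindex (fun a : 'I_n => [tuple a])) //=.
exists (fun I => tnth I ord0) => [a _|I _] //=.
by apply: val_inj; case: I => [[|a []]].
Qed.

Lemma sum_tuple2 (F : 2.-tuple 'I_n -> V) : \sum_I F I = \sum_a \sum_b F [tuple a; b].
Proof.
rewrite pair_big /= (reindex (fun p : 'I_n * 'I_n => [tuple p.1; p.2])) //=.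
exists (fun I => (tnth I ord0, tnth I (lift ord0 ord0))) => [[a b] _|I _] //=.
by apply: val_inj; case: I => [[|a [|b []]]].
Qed.

End TupleSums.

Lemma sum_ord2 (V : nmodType) (f : nat -> V) : \sum_(d < 2) f d = f 0%N + f 1%N.
Proof. by rewrite !big_ord_recr big_ord0 /= add0r. Qed.

Lemma sum_ord3 (V : nmodType) (f : nat -> V) : \sum_(d < 3) f d = f 0%N + f 1%N + f 2%N.
Proof. by rewrite !big_ord_recr big_ord0 /= add0r. Qed.

Section FrozenOperators.
Variables (R : realType) (n : nat).
Implicit Types (x xi nu : 'rV[R]_n) (h : 'M[R]_n) (Y : nat -> R -> cext R n) (t : R).

Lemma complex_sum (I : Type) (r : seq I) (P : pred I) (f g : I -> R) :
  \sum_(i <- r | P i) (f i +i* g i)%C =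
  ((\sum_(i <- r | P i) f i) +i* (\sum_(i <- r | P i) g i))%C.
Proof.
elim: r => [|i r IH]; first by rewrite !big_nil.
by rewrite !big_cons; case: (P i); rewrite IH.
Qed.

Lemma complex_sum_re (I : Type) (r : seq I) (P : pred I) (f : I -> R) :
  \sum_(i <- r | P i) (f i +i* 0)%C = ((\sum_(i <- r | P i) f i) +i* 0)%C.
Proof. by rewrite complex_sum [X in (_ +i* X)%C]big1. Qed.

Lemma complex_sum_im (I : Type) (r : seq I) (P : pred I) (f : I -> R) :
  \sum_(i <- r | P i) (0 +i* f i)%C = (0 +i* (\sum_(i <- r | P i) f i))%C.
Proof. by rewrite complex_sum [X in (X +i* _)%C]big1. Qed.

Lemma bilinE xi h nu : (xi *m h *m nu^T) 0 0 = \sum_a \sum_b xi 0 a * nu 0 b * h a b.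
Proof.
rewrite mxE exchange_big; apply: eq_bigr => b _; rewrite !mxE mulr_suml.
by apply: eq_bigr => a _; ring.
Qed.

Lemma complexify_scale (L : ext R n -> ext R n) (s : R) z :
  (forall e, L e = s *: e) -> complexify L z = (s +i* 0)%C *: z.
Proof.
move=> hL; apply: ext_eq => B; rewrite ffunE !hL !extZE !ffunE.
by case: (z B) => r m /=; apply/eqP; rewrite eq_complex /= !mul0r subr0 addr0 !eqxx.
Qed.

Lemma complexify_restr (i0 : 'I_n) z : complexify (@restr R n i0) z = restr i0 z.
Proof. by apply: ext_eq => B; rewrite !ffunE; case: (z _). Qed.

Lemma ins_signC i (A : {set 'I_n}) : ins_sign R[i] i A = (ins_sign R i A +i* 0)%C.
Proof.
rewrite /ins_sign -signr_odd -[in RHS]signr_odd; case: odd; rewrite ?expr0 ?expr1 //.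
by apply/eqP; rewrite eq_complex /= oppr0 !eqxx.
Qed.

Lemma complexify_iprod (i0 : 'I_n) (u : 'rV[R]_n) z :
  complexify (fun e => - restr i0 (iprod u e)) z =
  - restr i0 (iprod (\row_j (u 0 j +i* 0)%C) z).
Proof.
apply: ext_eq => B; rewrite [LHS]ffunE !extNE !restrE !iprodE.
set C := [set lift i0 b | b in B]%SET; pose a i := u 0 i * ins_sign R i C.
transitivity (- (\sum_(i | i \notin C)
   ((a i * complex.Re (z (i |: C)%SET)) +i* (a i * complex.Im (z (i |: C)%SET)))%C)).
  rewrite complex_sum; apply/eqP; rewrite eq_complex /=; apply/andP; split; apply/eqP;
    congr (- _); apply: eq_bigr => i _; by rewrite ffunE.
congr (- _); apply: eq_bigr => i _; rewrite mxE ins_signC; case: (z _) => r m /=.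
by apply/eqP; rewrite eq_complex /= !(mul0r, mulr0, subr0, addr0, add0r) !eqxx.
Qed.

Lemma coef_affine0 (a b : R[i]) : (a%:P + b *: 'X)`_0 = a.
Proof. by rewrite coefD coefC coefZ coefX mulr0 addr0. Qed.

Lemma coef_affine1 (a b : R[i]) : (a%:P + b *: 'X)`_1 = b.
Proof. by rewrite coefD coefC coefZ coefX mulr1 add0r. Qed.

Lemma prod2_poly (a1 b1 a2 b2 : R[i]) :
  (a1%:P + b1 *: 'X) * (a2%:P + b2 *: 'X) =
  (a1 * a2)%:P + (a1 * b2 + b1 * a2) *: 'X + (b1 * b2) *: 'X^2.
Proof. by rewrite -!mul_polyC !rmorphD !rmorphM /=; ring. Qed.

Lemma coef_quadratic (a b c : R[i]) : let p := a%:P + b *: 'X + c *: 'X^2 in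
  [/\ p`_0 = a, p`_1 = b & p`_2 = c].
Proof.
by move=> p; split; rewrite /p !(coefD, coefC, coefZ, coefX, coefXn) /=
  !(mulr0, mulr1, addr0, add0r).
Qed.

Lemma frozen0E (i0 : 'I_n) (P : operator R n n.-1) x xi nu Y t :
  (forall I e, top_coef (m := 0) P x I e = restr i0 e) ->
  frozen 0 P x xi nu Y t = restr i0 (Y 0%N t).
Proof.
move=> hP; rewrite /frozen sum_tuple0 big_ord1 big_nil coefC /= scale1r -complexify_restr.
by congr (complexify _ _); apply/funext => e; rewrite hP.
Qed.

Lemma frozen1E (i0 : 'I_n) (P : operator R n n.-1) h x xi nu Y t :
  (forall (I : 1.-tuple 'I_n) e,
     top_coef P x I e = - restr i0 (iprod (row (tnth I ord0) h) e)) ->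
  frozen 1 P x xi nu Y t =
  - (restr i0 (iprod (\row_j (0 +i* (xi *m h) 0 j)%C) (Y 0%N t)) +
     restr i0 (iprod (\row_j ((nu *m h) 0 j +i* 0)%C) (Y 1%N t))).
Proof.
move=> hP; rewrite /frozen sum_tuple1.
have top a z : complexify (top_coef P x [tuple a]) z =
    - restr i0 (iprod (\row_j (h a j +i* 0)%C) z).
  rewrite -[\row_j _](_ : \row_j (row a h 0 j +i* 0)%C = _) -?complexify_iprod.
    by congr (complexify _ _); apply/funext => e; rewrite hP.
  by apply/rowP => j; rewrite !mxE.
have lin (c : 'I_n -> R[i]) (u : 'rV[R[i]]_n) z :
    (forall j, u 0 j = \sum_a c a * (h a j +i* 0)%C) ->
    \sum_a c a *: restr i0 (iprod (\row_j (h a j +i* 0)%C) z) = restr i0 (iprod u z).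
  move=> uE; under eq_bigr => a _ do rewrite -restrZ.
  rewrite -restr_sum; congr restr; apply: ext_eq => B; rewrite ext_sumE iprodE.
  under eq_bigr => a _ do rewrite extZE iprodE mulr_sumr.
  rewrite exchange_big; apply: eq_bigr => j _; rewrite uE !mulr_suml.
  by apply: eq_bigr => a _; rewrite mxE !mulrA.
rewrite (eq_bigr (fun a =>
   - ((0 +i* xi 0 a)%C *: restr i0 (iprod (\row_j (h a j +i* 0)%C) (Y 0%N t)) +
   (nu 0 a +i* 0)%C *: restr i0 (iprod (\row_j (h a j +i* 0)%C) (Y 1%N t))))); last first.
  move=> a _; rewrite big_seq1.
  rewrite (sum_ord2 (fun d => ((0 +i* xi 0 a)%C%:P + (nu 0 a +i* 0)%C *: 'X)`_d *:
    complexify (top_coef P x [tuple a]) (Y d t))).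
  by rewrite coef_affine0 coef_affine1 !top !scalerN -opprD.
rewrite sumrN big_split /=; congr (- (_ + _)); apply: lin => j; rewrite !mxE.
  rewrite -complex_sum_im; apply: eq_bigr => a _.
  by apply/eqP; rewrite eq_complex /=; apply/andP; split; apply/eqP; ring.
rewrite -complex_sum_re; apply: eq_bigr => a _.
by apply/eqP; rewrite eq_complex /=; apply/andP; split; apply/eqP; ring.
Qed.

(** Each derivative d_j becomes i xi_j + nu_j d/dt, so this is
    - h(i xi + nu d/dt, i xi + nu d/dt) expanded in powers of d/dt. *)
Lemma frozen2E (P : operator R n n) h x xi nu Y t : h^T = h ->
  (forall (I : 2.-tuple 'I_n) e,
     top_coef P x I e = - h (tnth I ord0) (tnth I (lift ord0 ord0)) *: e) ->
  frozen 2 P x xi nu Y t =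
  ((xi *m h *m xi^T) 0 0 +i* 0)%C *: Y 0%N t -
  (0 +i* ((xi *m h *m nu^T) 0 0 *+ 2))%C *: Y 1%N t -
  ((nu *m h *m nu^T) 0 0 +i* 0)%C *: Y 2%N t.
Proof.
move=> sh hP; rewrite /frozen sum_tuple2.
have top a b z : complexify (top_coef P x [tuple a; b]) z = ((- h a b) +i* 0)%C *: z.
  by apply: complexify_scale => e; rewrite hP.
rewrite (eq_bigr (fun a => \sum_b (
   ((xi 0 a * xi 0 b * h a b) +i* 0)%C *: Y 0%N t +
   (0 +i* (- (xi 0 a * nu 0 b * h a b + nu 0 a * xi 0 b * h a b)))%C *: Y 1%N t +
   ((- (nu 0 a * nu 0 b * h a b)) +i* 0)%C *: Y 2%N t))); last first.
  move=> a _; apply: eq_bigr => b _.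
  rewrite big_cons big_seq1 prod2_poly.
  set c0 := (0 +i* xi 0 a)%C * (0 +i* xi 0 b)%C.
  set c1 := (0 +i* xi 0 a)%C * (nu 0 b +i* 0)%C + (nu 0 a +i* 0)%C * (0 +i* xi 0 b)%C.
  set c2 := (nu 0 a +i* 0)%C * (nu 0 b +i* 0)%C.
  rewrite (sum_ord3 (fun d => (c0%:P + c1 *: 'X + c2 *: 'X^2)`_d *:
    complexify (top_coef P x [tuple a; b]) (Y d t))).
  have [-> -> ->] := coef_quadratic c0 c1 c2.
  rewrite !top; move: (Y 0%N t) (Y 1%N t) (Y 2%N t) => y0 y1 y2.
  rewrite (scalerA c0) (scalerA c1) (scalerA c2).
  have -> : c0 * ((- h a b) +i* 0)%C = ((xi 0 a * xi 0 b * h a b) +i* 0)%C.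
    by apply/eqP; rewrite eq_complex /=; apply/andP; split; apply/eqP; ring.
  have -> : c1 * ((- h a b) +i* 0)%C =
      (0 +i* (- (xi 0 a * nu 0 b * h a b + nu 0 a * xi 0 b * h a b)))%C.
    by apply/eqP; rewrite eq_complex /=; apply/andP; split; apply/eqP; ring.
  have -> // : c2 * ((- h a b) +i* 0)%C = ((- (nu 0 a * nu 0 b * h a b)) +i* 0)%C.
  by apply/eqP; rewrite eq_complex /=; apply/andP; split; apply/eqP; ring.
have dsum (f g : 'I_n -> 'I_n -> R) (z : cext R n) :
    \sum_a \sum_b (f a b +i* g a b)%C *: z =
    ((\sum_a \sum_b f a b) +i* (\sum_a \sum_b g a b))%C *: z.
  rewrite -complex_sum scaler_suml; apply: eq_bigr => a _.
  by rewrite -complex_sum scaler_suml.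
under eq_bigr => a _ do rewrite !big_split /=.
rewrite !big_split /= !dsum.
set k0 := (_ +i* _)%C; set k1 := (_ +i* _)%C; set k2 := (_ +i* _)%C.
have -> : k0 = ((xi *m h *m xi^T) 0 0 +i* 0)%C.
  by rewrite /k0 -bilinE [X in (_ +i* X)%C]big1 // => a _; rewrite big1.
have -> : k1 = - (0 +i* ((xi *m h *m nu^T) 0 0 *+ 2))%C.
  rewrite /k1 [X in (X +i* _)%C]big1; last by move=> a _; rewrite big1.
  apply/eqP; rewrite eq_complex /= oppr0 eqxx /=; apply/eqP.
  rewrite mulr2n; under eq_bigr do rewrite sumrN big_split /=.
  rewrite sumrN big_split /= -bilinE; congr (- (_ + _)).
  rewrite exchange_big bilinE; apply: eq_bigr => b _; apply: eq_bigr => a _.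
  by rewrite -{1}sh mxE [nu _ _ * _]mulrC.
have -> : k2 = - ((nu *m h *m nu^T) 0 0 +i* 0)%C.
  rewrite /k2 [X in (_ +i* X)%C]big1; last by move=> a _; rewrite big1.
  apply/eqP; rewrite eq_complex /= oppr0 eqxx andbT; apply/eqP.
  by rewrite bilinE -sumrN; apply: eq_bigr => a _; rewrite sumrN.
by move: (Y 0%N t) (Y 1%N t) (Y 2%N t) => y0 y1 y2; rewrite !scaleNr.
Qed.

End FrozenOperators.

Lemma ext_coef_eq0 (F : fieldType) n (k0 k1 k2 : F) (y0 y1 y2 : ext F n) B :
  k0 *: y0 - k1 *: y1 - k2 *: y2 = 0 -> k0 * y0 B - k1 * y1 B - k2 * y2 B = 0.
Proof.
move=> e; transitivity ((k0 *: y0 - k1 *: y1 - k2 *: y2) B); last by rewrite e ffunE.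
by rewrite !extDE !extNE !extZE.
Qed.

Section HalfLineProblem.
Variables (R : realType) (n : nat) (i0 : 'I_n) (k : int).
Variables (P2 : operator R n n) (P0 P1 : operator R n n.-1).
Variables (x xi nu : 'rV[R]_n) (h : 'M[R]_n).
Local Notation a := ((nu *m h *m nu^T) 0 0).
Local Notation b := ((xi *m h *m nu^T) 0 0).
Local Notation c := ((xi *m h *m xi^T) 0 0).
Hypothesis h_sym : h^T = h.
Hypothesis P2_top : forall (I : 2.-tuple 'I_n) e,
  top_coef P2 x I e = - h (tnth I ord0) (tnth I (lift ord0 ord0)) *: e.
Hypothesis P0_top : forall (I : 0.-tuple 'I_n) e, top_coef P0 x I e = restr i0 e.
Hypothesis P1_top : forall (I : 1.-tuple 'I_n) e,
  top_coef P1 x I e = - restr i0 (iprod (row (tnth I ord0) h) e).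
Hypothesis a_gt0 : 0 < a.
Hypothesis disc_gt0 : 0 < a * c - b ^+ 2.
Hypothesis transverse : (nu *m h) 0 i0 != 0.

Definition half_line_solution (b1 b2 : cext R n.-1) (y : R -> cext R n) : Prop :=
  exists Y : nat -> R -> cext R n,
    [/\ Y 0%N = y,
        forall d, (d < 2)%N -> is_cderiv_halfline (Y d) (Y d.+1),
        forall t, 0 <= t -> homog k (y t),
        forall t, 0 <= t -> frozen 2 P2 x xi nu Y t = 0 &
        [/\ bounded_halfline y,
            frozen 0 P0 x xi nu Y 0 = b1 &
            frozen 1 P1 x xi nu Y 0 = b2]].

Let beta : R := b / a.
Let mu : R := Num.sqrt (a * c - b ^+ 2) / a.

Lemma mu_gt0 : 0 < mu. Proof. by rewrite divr_gt0 // sqrtr_gt0. Qed.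

Lemma b_eq : b = a * beta. Proof. by rewrite mulrC divfK // gt_eqF. Qed.

Lemma c_eq : c = a * (mu ^+ 2 + beta ^+ 2).
Proof.
rewrite /mu /beta !expr_div_n sqr_sqrtr ?ltW // -mulrDl subrK.
by field; rewrite gt_eqF.
Qed.

(* the characteristic root with negative real part *)
Let lam : R[i] := ((- mu) +i* (- beta))%C.
Let decay (t : R) : R[i] := (decay_re mu beta 1 0 t +i* decay_im mu beta 1 0 t)%C.

Lemma decayE t (z : R[i]) : decay t * z =
  (decay_re mu beta (complex.Re z) (complex.Im z) t +i*
   decay_im mu beta (complex.Re z) (complex.Im z) t)%C.
Proof.
case: z => r m; apply/eqP; rewrite eq_complex /= /decay_re /decay_im.
by apply/andP; split; apply/eqP; ring.
Qed.

Lemma lamE (z : R[i]) : lam * z =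
  ((- mu * complex.Re z + beta * complex.Im z) +i*
   (- mu * complex.Im z - beta * complex.Re z))%C.
Proof.
case: z => r m; apply/eqP; rewrite eq_complex /=.
by apply/andP; split; apply/eqP; ring.
Qed.

Lemma decay0 : decay 0 = 1.
Proof.
by rewrite /decay /decay_re /decay_im !mulr0 expR0 cos0 sin0 !mul1r ?mul0r ?addr0 ?subr0.
Qed.

Lemma lam_root : (c +i* 0)%C - (0 +i* (b *+ 2))%C * lam - (a +i* 0)%C * (lam * lam) = 0.
Proof.
apply/eqP; rewrite eq_complex /= c_eq b_eq.
by apply/andP; split; apply/eqP; ring.
Qed.

(** The covector i xi + lam nu raised by h.  On exp(lam t) y(0) the frozen delta_v
    is minus the contraction with this vector. *)
Definition normal_char : 'rV[R[i]]_n :=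
  lam *: (\row_j ((nu *m h) 0 j +i* 0)%C) + \row_j (0 +i* (xi *m h) 0 j)%C.

(** The real part of the normal component comes from lam nu h only, as Re lam = - mu. *)
Lemma normal_char_neq0 : normal_char 0 i0 != 0.
Proof.
move: transverse; rewrite /normal_char; move: (nu *m h) (xi *m h) => p q p0.
rewrite !mxE eq_complex negb_and; apply/orP; left => /=.
by rewrite mulr0 subr0 addr0 mulNr oppr_eq0 mulf_neq0 // gt_eqF ?mu_gt0.
Qed.

Lemma iprod_linear_vec (F : fieldType) m (s : F) (u v : 'rV[F]_m) w :
  iprod (s *: u + v) w = s *: iprod u w + iprod v w.
Proof.
rewrite [LHS]iprod_sum (iprod_sum u) (iprod_sum v) scaler_sumr -big_split.
by apply: eq_bigr => j _ /=; rewrite !mxE scalerDl scalerA.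
Qed.

Lemma boundary_frozen1 (Y : nat -> R -> cext R n) : Y 1%N 0 = lam *: Y 0%N 0 ->
  frozen 1 P1 x xi nu Y 0 = - restr i0 (iprod normal_char (Y 0%N 0)).
Proof.
move=> Y1; rewrite (frozen1E _ _ _ _ P1_top) Y1; congr (- _).
by rewrite iprodZr /normal_char iprod_linear_vec restrD !restrZ addrC.
Qed.

Lemma half_line_exists b1 b2 z : homog k z -> restr i0 z = b1 ->
  restr i0 (iprod normal_char z) = - b2 ->
  half_line_solution b1 b2 (fun t => decay t *: z).
Proof.
move=> hz z1 z2; pose Y (d : nat) t : cext R n := (decay t * lam ^+ d) *: z.
have Y0 : Y 0%N = fun t => decay t *: z by apply/funext => t; rewrite /Y expr0 mulr1.
exists Y; split=> //.
- move=> d _ A; have YE e t : Y e t A = decay t * (lam ^+ e * z A) by rewrite extZE mulrA.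
  have [dr di] := decay_deriv mu beta (complex.Re (lam ^+ d * z A)) (complex.Im (lam ^+ d * z A)).
  have lE : lam ^+ d.+1 * z A = lam * (lam ^+ d * z A) by rewrite exprS mulrA.
  split.
    have -> : (fun t => complex.Re (Y d t A)) =
        decay_re mu beta (complex.Re (lam ^+ d * z A)) (complex.Im (lam ^+ d * z A)).
      by apply/funext => t; rewrite YE decayE.
    have -> // : (fun t => complex.Re (Y d.+1 t A)) = decay_re mu beta
        (- mu * complex.Re (lam ^+ d * z A) + beta * complex.Im (lam ^+ d * z A))
        (- mu * complex.Im (lam ^+ d * z A) - beta * complex.Re (lam ^+ d * z A)).
    by apply/funext => t; rewrite YE decayE lE lamE.
  have -> : (fun t => complex.Im (Y d t A)) =
      decay_im mu beta (complex.Re (lam ^+ d * z A)) (complex.Im (lam ^+ d * z A)).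
    by apply/funext => t; rewrite YE decayE.
  have -> // : (fun t => complex.Im (Y d.+1 t A)) = decay_im mu beta
      (- mu * complex.Re (lam ^+ d * z A) + beta * complex.Im (lam ^+ d * z A))
      (- mu * complex.Im (lam ^+ d * z A) - beta * complex.Re (lam ^+ d * z A)).
  by apply/funext => t; rewrite YE decayE lE lamE.
- by move=> t _; apply: homogZ.
- move=> t _; rewrite (frozen2E _ _ _ _ h_sym P2_top).
  rewrite /Y expr0 mulr1 expr1 expr2 !scalerA -!scalerBl.
  rewrite [X in X *: _](_ : _ = decay t * ((c +i* 0)%C - (0 +i* (b *+ 2))%C * lam -
    (a +i* 0)%C * (lam * lam))); first by rewrite lam_root mulr0 scale0r.
  by ring.
split.
- exists (\sum_A (`|complex.Re (z A)| + `|complex.Im (z A)|)) => t A t0.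
  rewrite extZE decayE /=.
  have [hr hi] := decay_bounded beta (complex.Re (z A)) (complex.Im (z A)) mu_gt0 t0.
  have le : `|complex.Re (z A)| + `|complex.Im (z A)| <=
      \sum_A (`|complex.Re (z A)| + `|complex.Im (z A)|).
    by rewrite [leRHS](bigD1 A) //= lerDl sumr_ge0 // => B _; rewrite addr_ge0.
  by split; apply: le_trans le.
- by rewrite (frozen0E _ _ _ _ P0_top) Y0 decay0 scale1r.
rewrite boundary_frozen1; first by rewrite Y0 decay0 scale1r z2 opprK.
by rewrite /Y expr0 mulr1 expr1 decay0 mul1r scale1r.
Qed.

Lemma half_line_decays b1 b2 y : half_line_solution b1 b2 y ->
  [/\ forall t, 0 <= t -> y t = decay t *: y 0, restr i0 (y 0) = b1 &
      restr i0 (iprod normal_char (y 0)) = - b2].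
Proof.
case=> Y [<- dY _ eqY [[C bdY] b1E b2E]].
have main A : (forall t, 0 <= t -> Y 0%N t A = decay t * Y 0%N 0 A) /\
    Y 1%N 0 A = lam * Y 0%N 0 A.
  have [dr dm] := dY 0%N isT A; have [dr1 dm1] := dY 1%N isT A.
  have eqA t : 0 <= t ->
      a * complex.Re (Y 2%N t A) - b *+ 2 * complex.Im (Y 1%N t A) -
        c * complex.Re (Y 0%N t A) = 0 /\
      a * complex.Im (Y 2%N t A) + b *+ 2 * complex.Re (Y 1%N t A) -
        c * complex.Im (Y 0%N t A) = 0.
    move=> t0; have := eqY t t0; rewrite (frozen2E _ _ _ _ h_sym P2_top) => /ext_coef_eq0 - /(_ A).
    case: (Y 0%N t A) (Y 1%N t A) (Y 2%N t A) => [r0 m0] [r1 m1] [r2 m2] /= /eqP.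
    rewrite eq_complex /= => /andP[/eqP hr /eqP hi].
    split; apply: oppr_inj; rewrite oppr0; [rewrite -[RHS]hr | rewrite -[RHS]hi]; ring.
  have [E1 E2 E3 E4] := bounded_complex_decay mu_gt0 (lt0r_neq0 a_gt0) b_eq c_eq dr dr1 dm dm1
    (fun t t0 => (eqA t t0).1) (fun t t0 => (eqA t t0).2) (fun t t0 => bdY t A t0).
  split=> [t t0|].
    rewrite decayE; apply/eqP; rewrite eq_complex /=.
    by rewrite /decay_re /decay_im -E1 // -E2 // !eqxx.
  by rewrite lamE; apply/eqP; rewrite eq_complex /= E3 E4 !eqxx.
have Y1 : Y 1%N 0 = lam *: Y 0%N 0.
  by apply/ffunP => A; rewrite extZE; have [_ ->] := main A.
split.
- by move=> t t0; apply: ext_eq => A; rewrite extZE; have [yE _] := main A; exact: yE.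
- by rewrite -b1E (frozen0E _ _ _ _ P0_top).
- by rewrite -b2E boundary_frozen1 // opprK.
Qed.

Lemma half_line_well_posed b1 b2 : homog k b1 -> homog (k - 1) b2 ->
  exists2 y, half_line_solution b1 b2 y &
    forall y', half_line_solution b1 b2 y' -> forall t, 0 <= t -> y' t = y t.
Proof.
move=> hb1 hb2; have hb2' : homog (k - 1) (- b2) by rewrite -scaleN1r; exact: homogZ.
have [z [hz z1 z2]] := restr_iprod_surj normal_char_neq0 hb1 hb2'.
exists (fun t => decay t *: z); first exact: half_line_exists.
move=> y' /half_line_decays[yE y1 y2] t t0; rewrite yE //; congr (_ *: _).
by apply: (restr_iprod_inj normal_char_neq0); rewrite ?y1 ?y2.
Qed.

End HalfLineProblem.

(** * Ellipticity *)

Local Open Scope classical_set_scope.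

Theorem theorem4p1 (R : realType) (n : nat) (M : topologicalType)
    (A : atlas R n M) (hM : hausdorff_space M) (cM : compact [set: M])
    (o : orientation A) (g : riemannian A) (v : vector_field A) (k : nat) :
  lopatinskii_shapiro g (normal_bvp o g v k).
Proof.
move=> c x Ox.
have openO := img_open c.
set G := metric g c; set V := vfield v c; set s := osign o c.
have s_sign y : img c y -> s y = 1 \/ s y = -1 by exact: osignP.
have G_sym y : img c y -> (G y)^T = G y by exact: Defs.metric_sym.
have G_pos y : img c y -> posdef (G y) by exact: metric_pos.
have G_C1 a b : C1 (img c) (fun y => G y a b).
  by apply: smooth_C1 => //; exact: metric_smooth.
have V_C1 a : C1 (img c) (fun y => V y 0 a).
  by apply: smooth_C1 => //; exact: vfield_smooth.
have s_cts : C0 (img c) s.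
  move=> y Oy; have /subspace_continuousP/(_ y Oy) cy := osign_cont (o := o) (c := c).
  move=> P nP.
  have n1 : nbhs y (fun z => img c z -> P (s z)) by exact: (cy _ nP).
  have n2 : nbhs y (fun z => halfspace z -> img c z) by exact: (near_O openO Oy).
  by apply: (filterS _ (filterI n1 n2)) => z [Pz hz] /hz /Pz.
have lap := @top_coef_laplace_v R n (img c) s G V openO s_sign s_cts G_C1 G_sym G_pos V_C1 x.
have cod := @top_coef_codiff_v R n (img c) s G V openO s_sign s_cts G_C1 G_sym G_pos V_C1 x.
set h := cometric (G x) (V x) in lap cod.
have h_sym : h^T = h by exact: cometric_sym (G_sym x Ox).
have Gi_pos := posdef_inv (G_sym x Ox) (G_pos x Ox).
have hE (u w : 'rV[R]_n) : (u *m h *m w^T) 0 0 =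
    (u *m invmx (G x) *m w^T) 0 0 + (u *m (V x)^T) 0 0 * (w *m (V x)^T) 0 0.
  rewrite /h /cometric mulmxDr mulmxDl mxE; congr (_ + _).
  rewrite mulmxA -mulmxA mxE big_ord1; congr (_ * _).
  by rewrite -[V x *m w^T]trmxK trmx_mul trmxK mxE.
have h_pos (u : 'rV[R]_n) : u != 0 -> 0 < (u *m h *m u^T) 0 0.
  by move=> nz; rewrite hE ltr_wpDr ?Gi_pos // -expr2 sqr_ge0.
split.
- move=> xi nz e he.
  have symE w : symbol 2 (laplace_v s G V) x xi w = - (xi *m h *m xi^T) 0 0 *: w.
    rewrite /symbol sum_tuple2 bilinE -sumrN scaler_suml; apply: eq_bigr => a _.
    rewrite -sumrN scaler_suml; apply: eq_bigr => b _.
    rewrite lap // !(tnth_nth a) /= !big_cons big_nil mulr1 scalerA; congr (_ *: _).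
    by rewrite mulrN.
  have nz' : - (xi *m h *m xi^T) 0 0 != 0 by rewrite oppr_eq0 gt_eqF // h_pos.
  exists ((- (xi *m h *m xi^T) 0 0)^-1 *: e); split=> [|w [_ /= <-]].
    by split; [exact: homogZ | rewrite /= symE scalerA mulfV // scale1r].
  by rewrite symE scalerA mulVf // scale1r.
move=> i0 i00 _ xi nz orth b1 b2 hb1 hb2.
set nu := normal_cov g c i0 x.
have Gi00 : 0 < invmx (G x) i0 i0.
  have d0 : delta_mx 0 i0 != 0 :> 'rV[R]_n.
    by apply/eqP => /rowP/(_ i0); rewrite !mxE !eqxx; apply/eqP; exact: oner_neq0.
  have := Gi_pos _ d0; rewrite -rowE mxE (bigD1 i0) //= !mxE !eqxx mulr1 big1 ?addr0 //.
  by move=> j /negbTE ji; rewrite !mxE ji mulr0.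
pose kappa := (Num.sqrt (invmx (G x) i0 i0))^-1.
have kappa0 : kappa != 0 by rewrite invr_eq0 gt_eqF // sqrtr_gt0.
have nu_nz : nu != 0.
  apply/eqP => /rowP/(_ i0); rewrite /nu /normal_cov !mxE !eqxx mulr1 => /eqP.
  by rewrite (negbTE kappa0).
have N_gt0 := Gi_pos _ nu_nz; have X_gt0 := Gi_pos _ nz.
have orth' : (xi *m invmx (G x) *m nu^T) 0 0 = 0.
  by rewrite -[RHS]orth /normal_vec trmx_mul trmx_inv G_sym // mulmxA.
have a_gt0 := h_pos _ nu_nz.
have disc : 0 < (nu *m h *m nu^T) 0 0 * (xi *m h *m xi^T) 0 0 - (xi *m h *m nu^T) 0 0 ^+ 2.
  (* With N = g(nu, nu), X = g(xi, xi), p = nu(v), q = xi(v) and g(xi, nu) = 0,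
     h(nu, nu) = N + p^2, h(xi, nu) = p q and h(xi, xi) = X + q^2. *)
  rewrite !hE orth'; set N := (nu *m _ *m _) 0 0; set X := (xi *m _ *m _) 0 0.
  set p := (nu *m _) 0 0; set q := (xi *m _) 0 0.
  rewrite (_ : _ - _ = N * X + (N * q ^+ 2 + p ^+ 2 * X)); last by ring.
  by rewrite ltr_wpDr ?mulr_gt0 // addr_ge0 // mulr_ge0 ?sqr_ge0 // ltW.
have transv : (nu *m h) 0 i0 != 0.
  apply: contraTneq a_gt0 => z; rewrite mxE (bigD1 i0) //= z mul0r add0r big1 ?ltxx // => j ji.
  by rewrite /nu /normal_cov !mxE (negbTE ji) /= !mulr0.
have bop1_top (I : 0.-tuple 'I_n) e :
    top_coef (fun w y => restr i0 (w y)) x I e = restr i0 e.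
  by rewrite /top_coef invr1 scale1r (tuple0 I) big_nil scale1r.
have bop2_top (I : 1.-tuple 'I_n) e :
    top_coef (fun w y => restr i0 (codiff_v s G V w y)) x I e =
    - restr i0 (iprod (row (tnth I ord0) h) e).
  have := cod I e Ox; rewrite /top_coef invr1 !scale1r => ->.
  by rewrite -scaleN1r restrZ scaleN1r.
exact: (half_line_well_posed h_sym (fun I e => lap I e Ox) bop1_top bop2_top
  a_gt0 disc transv hb1 hb2).
Qed.
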